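(* Let $N\geq 1$ and $d\geq 2$, and let $k$ be an algebraically closed field of characteristic $0$ or of characteristic $p>d$. Then the locus of post-critically finite maps in $\mathcal{P}_{N,d}(k)$ is a countable union of $0$-dimensional subvarieties.
   Context: A morphism $f:\mathbb{P}^N\to\mathbb{P}^N$ of degree $d$ is called a monic polynomial if there is a hyperplane $H\subseteq\mathbb{P}^N$ which is totally invariant under $f$ and such that the restriction of $f$ to $H\cong\mathbb{P}^{N-1}$ is the $d$th power map $[x_0:\cdots:x_{N-1}]\mapsto[x_0^d:\cdots:x_{N-1}^d]$ in some coordinates. Equivalently, in suitable homogeneous coordinates $f=[f_0:\cdots:f_N]$ with $f_N=x_N^d$ and $f_i=x_i^d+x_Ng_i(x_0,\dots,x_N)$ for $0\le i<N$, with $g_i$ homogeneous of degree $d-1$. Let $\mathcal{M}_{N,d}$ denote the moduli space of degree-$d$ endomorphisms of $\mathbb{P}^N$, i.e. the space of such morphisms (parametrized by their coefficients) modulo conjugation by $\mathrm{PGL}_{N+1}$; $\mathcal{P}_{N,d}\subseteq\mathcal{M}_{N,d}$ is the subvariety consisting of conjugacy classes of monic polynomials. A morphism $f$ is post-critically finite (PCF) if the forward orbit of its ramification (critical) locus under $f$ is supported on a finite union of hypersurfaces, i.e. the sequence of (reduced) images $f^n(R_f)$, $n\ge 0$, of the ramification divisor $R_f$ takes only finitely many values. *)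

(* Defs.v *)
From HB Require Import structures.
From mathcomp Require Import all_boot all_order all_algebra.
From mathcomp Require Import mpoly.
Set Implicit Arguments. Unset Strict Implicit. Unset Printing Implicit Defensive.
Import Order.TTheory GRing.Theory Num.Theory.
Local Open Scope ring_scope.

(* A homogeneous polynomial of degree e (the zero polynomial counts). *)
Definition homogeneous_of_degree (k : fieldType) (n e : nat) (p : {mpoly k[n]}) : bool :=
  all (fun m => mdeg m == e) (msupp p).

(* A (polynomial) endomorphism of P^N written in homogeneous coordinates
   x_0, ..., x_N : a family F_0, ..., F_N of polynomials in N+1 variables. *)
Definition endo (k : fieldType) (N : nat) := 'I_N.+1 -> {mpoly k[N.+1]}.

(* Points of k^{N+1} (affine cone over P^N). *)
Definition vect (k : fieldType) (N : nat) := 'I_N.+1 -> k.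

Definition endo_eval (k : fieldType) (N : nat) (F : endo k N) (x : vect k N) : vect k N :=
  fun i => (F i).@[x].

Definition monic_poly_map (k : fieldType) (N d : nat) (g : 'I_N -> {mpoly k[N.+1]}) : endo k N :=
  fun i => match unlift ord_max i with
           | Some j => 'X_i ^+ d + 'X_(ord_max) * g j
           | None => 'X_(ord_max) ^+ d
           end.

Definition normal_form_data (k : fieldType) (N d : nat) (g : 'I_N -> {mpoly k[N.+1]}) : Prop :=
  forall j, homogeneous_of_degree d.-1 (g j).

(* Jacobian determinant of F; its zero locus is the (support of the)
   ramification divisor R_f (for char k = 0 or char k > d). *)
Definition jacobian_det (k : fieldType) (N : nat) (F : endo k N) : {mpoly k[N.+1]} :=
  \det (\matrix_(i, j) mderiv j (F i)).

Definition crit_cone (k : fieldType) (N : nat) (F : endo k N) (x : vect k N) : Prop :=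
  (jacobian_det F).@[x] = 0.

(* Cone over f^n(R_f):  { F^n(x) | x in the cone over R_f }. *)
Definition crit_image (k : fieldType) (N : nat) (F : endo k N) (n : nat) (y : vect k N) : Prop :=
  exists x, crit_cone F x /\ y = iter n (endo_eval F) x.

(* Post-critically finite: the sequence of (reduced) images f^n(R_f), n >= 0,
   takes only finitely many values. *)
Definition PCF (k : fieldType) (N : nat) (F : endo k N) : Prop :=
  exists M : nat, forall n : nat, exists i : nat,
    (i < M)%N /\ (forall y, crit_image F n y <-> crit_image F i y).

Definition mat_act (k : fieldType) (N : nat) (A : 'M[k]_N.+1) (x : vect k N) : vect k N :=
  fun i => \sum_j A i j * x j.

(* PGL_{N+1}-conjugacy of endomorphisms of P^N:  phi o g = f o phi,
   with phi given by an invertible matrix A, the homogeneous lifts agreeing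
   up to a nonzero scalar. *)
Definition conjugate (k : fieldType) (N : nat) (F G : endo k N) : Prop :=
  exists (A : 'M[k]_N.+1) (c : k), A \in unitmx /\ c != 0 /\
    forall x : vect k N,
      mat_act A (endo_eval G x) = (fun i => c * endo_eval F (mat_act A x) i).

(* Main.v *)
Require Import Defs.
From HB Require Import structures.
From mathcomp Require Import all_boot all_order all_algebra all_field.
From mathcomp Require Import generic_quotient ring_quotient.
From mathcomp Require boolp classical_sets.
From mathcomp Require Import mpoly.
From mathcomp Require Import ring zify.
Set Implicit Arguments. Unset Strict Implicit. Unset Printing Implicit Defensive.
Import GRing.Theory.
Local Open Scope ring_scope.

(** A normal form can be conjugated by a translation so that the coefficient of
    x_j^(d-1) in g_j vanishes for every j.  The heart of the matter is that the
    coefficients of a PCF map normalised in this way are algebraic over the prime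
    field, which leaves countably many maps.

    If some coefficient were transcendental, Zorn's lemma would provide a valuation
    ring O of k which contains the inverses of the nonzero integers but not that
    coefficient.  Rescaling the hyperplane coordinate x_N by an element rho with
    |rho| > 1 makes all the coefficients integral, with a nonzero reduction.  Suppose
    the reduced map F = (x_j^d + x_N g_j) has an affine critical point none of whose
    images F_j vanishes.  It lifts to a critical point whose n-th image has all its
    affine coordinates of size |rho|^(d^n) once x_N is normalised to 1; far away from
    the origin the map is close to the power map, so a critical point cannot reach such
    a point in fewer steps, and the n-th images of the critical locus are pairwise
    distinct: the map is not PCF.

    Otherwise every prime factor of the affine Jacobian J divides some F_j.  If P^m
    exactly divides F_j then P^(m-1) exactly divides J (this uses p > d), so comparing
    the exponents of x_j on the hyperplane at infinity, where F_j = x_j^d and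
    J = d^N prod x_i^(d-1), shows that F_j is the d-th power of a linear form
    x_j + c x_N.  The normalisation forces c = 0, so the reduction of g_j is zero, a
    contradiction. *)

(** * Polynomials over a factorial ring *)

Definition divides (R : comNzRingType) (a b : R) := exists c, b = c * a.

Definition prime_elt (R : idomainType) (p : R) :=
  [/\ p != 0, ~ divides p 1
    & forall a b, divides p (a * b) -> divides p a \/ divides p b].

(** Units are the divisors of 1. Only the existence of a factorisation into primes is asked for: its
    uniqueness follows from primality. *)
Definition factorial_ring (R : idomainType) :=
  forall a : R, a != 0 -> exists u s,
    [/\ divides u 1, forall p, p \in s -> prime_elt p & a = u * \prod_(p <- s) p].

Section Divisibility.
Variable R : idomainType.
Implicit Types a b p u : R.

Lemma divides_refl a : divides a a.
Proof. by exists 1; rewrite mul1r. Qed.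

Lemma divides0 a : divides a 0.
Proof. by exists 0; rewrite mul0r. Qed.

Lemma divides_mull a b c : divides a b -> divides a (c * b).
Proof. by move=> [e ->]; exists (c * e); rewrite mulrA. Qed.

Lemma divides_mulr a b c : divides a b -> divides a (b * c).
Proof. by rewrite mulrC; apply: divides_mull. Qed.

Lemma divides_trans b a c : divides a b -> divides b c -> divides a c.
Proof. by move=> dab [e ->]; apply: divides_mull. Qed.

Lemma dividesD a b c : divides a b -> divides a c -> divides a (b + c).
Proof. by move=> [e ->] [f ->]; exists (e + f); rewrite mulrDl. Qed.

Lemma divides_subl a b c : divides a (b + c) -> divides a c -> divides a b.
Proof. by move=> [e E] [f F]; exists (e - f); rewrite mulrBl -E -F addrK. Qed.

Lemma prime_divides_prod p (I : eqType) (s : seq I) (F : I -> R) : prime_elt p ->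
  divides p (\prod_(i <- s) F i) -> exists2 i, i \in s & divides p (F i).
Proof.
move=> [_ p1 pM]; elim: s => [|i s IHs]; first by rewrite big_nil.
rewrite big_cons => /pM [dpi|/IHs [j js dpj]]; first by exists i; rewrite ?mem_head.
by exists j; rewrite // inE js orbT.
Qed.

Lemma divides_unit u a : divides u 1 -> divides u a.
Proof. by move=> [v uv]; exists (a * v); rewrite -mulrA -uv mulr1. Qed.

Lemma prime_assoc p q : prime_elt p -> prime_elt q -> divides p q ->
  exists2 v, divides v 1 & q = v * p.
Proof.
move=> [p0 p1 pM] [q0 q1 qM] [c E]; exists c => //.
have : divides q (c * p) by exists 1; rewrite mul1r.
case/qM=> [[e Ec]|[e Ep]].
- case: p1; exists e; apply: (mulfI q0).
  by rewrite mulr1 {1}E Ec; ring.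
- exists e; apply: (mulfI p0).
  by rewrite mulr1 {1}Ep E; ring.
Qed.

End Divisibility.

(** * Gauss's theorem: polynomials over a factorial ring *)

Section FactorialPoly.
Variable R : idomainType.
Implicit Types (f g h : {poly R}) (p c u : R).

Lemma divides_polyC p c : divides p c -> divides p%:P c%:P.
Proof. by move=> [e ->]; exists e%:P; rewrite polyCM. Qed.

Lemma divides_polyC_coef p f i : divides p%:P f -> divides p f`_i.
Proof. by move=> [g ->]; exists g`_i; rewrite mulrC coefCM mulrC. Qed.

(** Gauss's lemma, by induction on the total size: if [p] divides [f * g] it divides the product of
    the leading coefficients, hence one of them, and the corresponding leading term can be removed
    without affecting divisibility by [p]. *)
Lemma prime_polyC p : prime_elt p -> prime_elt p%:P.
Proof.
move=> [p0 p1 pM]; split; first by rewrite polyC_eq0.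
  by move=> /(divides_polyC_coef 0); rewrite coef1.
move=> f g; have [n] := ubnP (size f + size g)%N.
elim: n => // n IHn in f g *; rewrite ltnS => szfg dfg.
have [->|f0] := eqVneq f 0; first by left; apply: divides0.
have [->|g0] := eqVneq g 0; first by right; apply: divides0.
have red (h : {poly R}) : h != 0 -> divides p (lead_coef h) ->
    exists k : {poly R}, (size k < size h)%N /\ divides p%:P (h - k).
  move=> h0 [c E]; exists (h - (lead_coef h) *: 'X^((size h).-1)); split.
    rewrite -[X in (_ < X)%N]prednK ?size_poly_gt0 // ltnS.
    apply/leq_sizeP=> i; rewrite coefB coefZ coefXn leq_eqVlt => /orP [/eqP <-|lt_i].
      by rewrite eqxx mulr1 subrr.
    rewrite gtn_eqF // mulr0 subr0 nth_default //.
    by move: lt_i; rewrite prednK ?size_poly_gt0.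
  by rewrite subKr E -mul_polyC; exists (c%:P * 'X^((size h).-1)); rewrite polyCM mulrAC.
have := divides_polyC_coef (size f + size g).-2 dfg.
have -> : (f * g)`_(size f + size g).-2 = lead_coef f * lead_coef g.
  by rewrite -lead_coefM lead_coefE size_mul.
move=> /pM [] /red [//|k [szk dk]].
- have [|//|dkf|] := IHn k g; last by right.
  + by apply: leq_trans szfg; rewrite ltn_add2r.
  + have -> : k * g = f * g - (f - k) * g by rewrite mulrBl subKr.
    apply: divides_subl (divides_mulr g dk).
    by rewrite subrK.
  by left; rewrite -[f](subrK k); apply: dividesD.
- have [|//| |dkg] := IHn f k; last 2 first.
  + by left.
  + by right; rewrite -[g](subrK k); apply: dividesD.
  + by apply: leq_trans szfg; rewrite ltn_add2l.
  have -> : f * k = f * g - f * (g - k) by rewrite mulrBr subKr.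
  apply: divides_subl (divides_mull f dk).
  by rewrite subrK.
Qed.

Definition primitive_poly f := forall p, prime_elt p -> ~ divides p%:P f.

Hypothesis factR : factorial_ring R.

(** The prime factors of [c] are cancelled one at a time: as none of them divides the primitive [f],
    each divides the cofactor. *)
Lemma divides_strip f c h : primitive_poly f -> c != 0 ->
  divides f (c%:P * h) -> divides f h.
Proof.
move=> primf /factR [u [s [[v uv] ps ->]]].
elim: s ps => [|p s IHs] ps.
  rewrite big_nil mulr1 => [[q E]]; exists (v%:P * q).
  by rewrite -mulrA -E mulrA -polyCM -uv mul1r.
rewrite big_cons mulrCA polyCM -mulrA => [[q E]].
have pp : prime_elt p by apply: ps; rewrite mem_head.
have [p0 _ _] := pp; have [_ _ pM] := prime_polyC pp.
have : divides p%:P (q * f) by rewrite -E; apply: divides_mulr; apply: divides_refl.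
case/pM=> [[q' Eq]|]; last by move/primf.
apply: IHs; first by move=> r rs; apply: ps; rewrite inE rs orbT.
exists q'; apply: (@mulfI _ p%:P); first by rewrite polyC_eq0.
by rewrite E Eq mulrCA mulrA.
Qed.

(** Each prime factor of [c] stays prime in [{poly R}], so it divides [e] or [q] and can be removed
    there. A factorisation over the fraction field thus becomes one over [R]. *)
Lemma factor_strip c f e q : c != 0 -> c%:P * f = e * q ->
  exists e1 q1 c1 c2, [/\ f = e1 * q1, e = c1%:P * e1, q = c2%:P * q1, c1 != 0 & c2 != 0].
Proof.
move=> /factR [u [s [[v uv] ps ->]]].
have u0 : u != 0 by apply: contraTneq (oner_neq0 R) => u0; rewrite uv u0 mulr0 eqxx.
elim: s ps e q => [|p s IHs] ps e q.
  rewrite big_nil mulr1 => E; exists (v%:P * e), q, u, 1; split; rewrite ?oner_neq0 //.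
  - by rewrite -mulrA -E mulrA -polyCM -uv mul1r.
  - by rewrite mulrA -polyCM mulrC [u * v]mulrC -uv mulr1.
  - by rewrite mul1r.
rewrite big_cons mulrCA polyCM -mulrA => E.
have pp : prime_elt p by apply: ps; rewrite mem_head.
have [p0 _ _] := pp; have [_ _ pM] := prime_polyC pp.
have pP0 : p%:P != 0 by rewrite polyC_eq0.
have ps' r : r \in s -> prime_elt r by move=> rs; apply: ps; rewrite inE rs orbT.
have : divides p%:P (e * q) by rewrite -E; apply: divides_mulr; apply: divides_refl.
case/pM=> [[e' Ee]|[q' Eq]].
- have [|e1 [q1 [c1 [c2 [-> E1 -> c10 c20]]]]] := IHs ps' e' q.
    by apply: (mulfI pP0); rewrite E Ee mulrA [e' * _]mulrC.
  exists e1, q1, (p * c1), c2; split => //; last by rewrite mulf_neq0.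
  by rewrite Ee E1 polyCM mulrC mulrA.
- have [|e1 [q1 [c1 [c2 [-> -> E1 c10 c20]]]]] := IHs ps' e q'.
    by apply: (mulfI pP0); rewrite E Eq mulrA mulrC.
  exists e1, q1, c1, (p * c2); split => //; last by rewrite mulf_neq0.
  by rewrite Eq E1 polyCM mulrC mulrA.
Qed.

(** Induction on the number of prime factors of the leading coefficient: extracting a constant prime
    from [f] uses up one of them. *)
Lemma primitive_part f : f != 0 ->
  exists c g, [/\ f = c%:P * g, c != 0 & primitive_poly g].
Proof.
move=> f0; have lf0 : lead_coef f != 0 by rewrite lead_coef_eq0.
have [u [s [u1 ps E]]] := factR lf0.
have [n] := ubnP (size s); elim: n => // n IHn in f f0 lf0 u s u1 ps E *.
rewrite ltnS => szs; case: (boolp.EM (primitive_poly f)) => [primf|].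
  by exists 1, f; split; rewrite ?mul1r ?oner_neq0.
move=> /boolp.existsNP [p /boolp.not_implyP [pp /boolp.contrapT [g Ef]]].
have [p0 _ pM] := pp.
have g0 : g != 0 by apply: contraNneq f0 => g0; rewrite Ef g0 mul0r.
have lE : lead_coef f = lead_coef g * p by rewrite Ef lead_coefM lead_coefC.
have : divides p (u * \prod_(q <- s) q) by rewrite -E lE; exists (lead_coef g).
case/pM=> [dpu|/(prime_divides_prod pp) [q qs dpq]].
  by case: pp => _ + _; case; apply: divides_trans u1.
have [v v1 Eq] := prime_assoc pp (ps _ qs) dpq.
have lg0 : lead_coef g != 0 by rewrite lead_coef_eq0.
have [||||c [h [Eg c0 primh]]] := IHn g g0 lg0 (u * v) (rem q s).
- case: u1 v1 => [x ux] [y vy]; exists (x * y).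
  by rewrite mulrACA -ux -vy mulr1.
- by move=> r /mem_rem; apply: ps.
- apply: (mulIf p0); rewrite -lE E (perm_big _ (perm_to_rem qs)) /= big_cons Eq.
  by rewrite -!mulrA [p * _]mulrC.
- rewrite size_rem //; case: s qs szs {ps E} => //= *; exact.
by exists (c * p), h; split => //; [rewrite Ef {1}Eg polyCM mulrAC | rewrite mulf_neq0].
Qed.

Lemma min_size_elt (P : {poly R} -> Prop) f : P f -> f != 0 ->
  exists e, [/\ P e, e != 0 & forall g, P g -> g != 0 -> (size e <= size g)%N].
Proof.
have [n] := ubnP (size f); elim: n => // n IHn in f *; rewrite ltnS => szf Pf f0.
case: (boolp.EM (forall g, P g -> g != 0 -> (size f <= size g)%N)) => [?|].
  by exists f.
move=> /boolp.existsNP [g /boolp.not_implyP [Pg /boolp.not_implyP [g0 /negP]]].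
by rewrite -ltnNge => ltgf; apply: IHn Pg g0; apply: leq_trans szf.
Qed.

(* A generator, up to constants, of the ideal (f, g) of K[X], K = Frac R. *)
Lemma pseudo_gcd f g : f != 0 -> exists e a b c1 q1 c2 q2,
  [/\ e != 0, e = a * f + b * g, c1 != 0 /\ c1%:P * f = q1 * e
    & c2 != 0 /\ c2%:P * g = q2 * e].
Proof.
move=> f0; pose I h := exists a b, h = a * f + b * g.
have If : I f by exists 1, 0; rewrite mul1r mul0r addr0.
have Ig : I g by exists 0, 1; rewrite mul1r mul0r add0r.
have [e [[a [b Ee]] e0 mine]] := min_size_elt If f0.
(* Pseudo-division by [e]: the remainder lies in the ideal and is smaller than [e], so it is 0 by
   minimality. *)
have div h : I h -> exists c q, c != 0 /\ c%:P * h = q * e.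
  move=> [x [y Eh]]; exists (lead_coef e ^+ Pdiv.IdomainDefs.scalp h e), (Pdiv.IdomainDefs.divp h e).
  split; first by rewrite expf_neq0 // lead_coef_eq0.
  rewrite mul_polyC Pdiv.Idomain.divp_eq.
  suff /eqP -> : Pdiv.IdomainDefs.modp h e == 0 by rewrite addr0.
  apply: contraT => r0; have := Pdiv.Idomain.ltn_modp h e.
  rewrite e0 ltnNge mine // /I.
  have -> : Pdiv.IdomainDefs.modp h e =
     (lead_coef e ^+ Pdiv.IdomainDefs.scalp h e)%:P * h - Pdiv.IdomainDefs.divp h e * e.
    by rewrite mul_polyC Pdiv.Idomain.divp_eq addrC addKr.
  set c := _%:P; set q := Pdiv.IdomainDefs.divp h e.
  exists (c * x - q * a), (c * y - q * b); rewrite Eh Ee !mulrBl !mulrDr !mulrA.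
  by rewrite opprD addrACA.
have [c1 [q1 H1]] := div f If; have [c2 [q2 H2]] := div g Ig.
by exists e, a, b, c1, q1, c2, q2.
Qed.

(** When [f] divides [g * h], let [e] be the pseudo-gcd of [f] and [g]. By irreducibility, either
    [f] and [e] agree up to constants, and [f] divides a constant multiple of [g]; or [e] is
    constant, and the Bezout relation multiplied by [h] shows that [f] divides a constant multiple
    of [h]. Primitivity removes the constants. *)
Lemma primitive_irreducible_prime f : primitive_poly f -> (1 < size f)%N ->
  (forall g h, f = g * h -> (size g <= 1)%N \/ (size h <= 1)%N) -> prime_elt f.
Proof.
move=> primf szf irrf.
have f0 : f != 0 by rewrite -size_poly_gt0 ltnW.
split=> //.
  move=> [g E]; have := congr1 (fun q : {poly R} => size q) E; have g0 : g != 0.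
    by apply: contra_eqN E => /eqP ->; rewrite mul0r oner_eq0.
  rewrite size_poly1 size_mul // => /esym; move: szf; rewrite -(size_poly_gt0 g) in g0.
  by case: (size g) g0 (size f) => // m _ [|[|k]] //; rewrite !addnS.
move=> g h [w Ew]; have [e [a [b [c1 [q1 [c2 [q2 [e0 Ee [c10 E1] [c20 E2]]]]]]]]] := pseudo_gcd g f0.
rewrite mulrC in E1.
rewrite [f * _]mulrC in E1.
have [x [y [c3 [c4 [Ef Eq Ee' c30 c40]]]]] := factor_strip c10 E1.
have cst (z : {poly R}) : z != 0 -> (size z <= 1)%N -> exists2 c, c != 0 & z = c%:P.
  by move=> z0 /size1_polyC Ez; exists z`_0; rewrite -?Ez // -polyC_eq0 -Ez.
have [x0 y0] : x != 0 /\ y != 0 by apply/andP; rewrite -negb_or -mulf_eq0 -Ef.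
case: (irrf _ _ Ef) => [szx|szy].
- left; have [c c0 Ex] := cst x x0 szx.
  apply: (@divides_strip _ (c2 * c)) => //; first by rewrite mulf_neq0.
  exists (q2 * c4%:P); rewrite polyCM mulrAC E2 Ee' Ef Ex.
  by rewrite -!mulrA [y * _]mulrC.
- right; have [c c0 Ey] := cst y y0 szy.
  apply: (@divides_strip _ (c4 * c)) => //; first by rewrite mulf_neq0.
  rewrite polyCM -Ey -Ee' Ee mulrDl -[b * g * h]mulrA Ew mulrAC mulrA.
  by rewrite -mulrDl; eexists.
Qed.

(** The content is factored in [R]; the primitive part is split, by induction on its size, until it
    is irreducible. *)
Lemma factorial_poly : factorial_ring {poly R}.
Proof.
pose has_factors (a : {poly R}) := exists (u : {poly R}) (s : seq {poly R}),
  [/\ divides u 1, forall p : {poly R}, p \in s -> prime_elt p & a = u * \prod_(p <- s) p].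
have cst c : c != 0 -> has_factors c%:P.
  move=> /factR [u [s [u1 ps ->]]]; exists u%:P, (map polyC s); split.
  - exact: (divides_polyC u1).
  - by move=> p /mapP [q qs ->]; apply/prime_polyC/ps.
  - by rewrite polyCM rmorph_prod big_map.
have mul (a b : {poly R}) : has_factors a -> has_factors b -> has_factors (a * b).
  move=> [u [s [[x ux] ps ->]]] [v [t [[y vy] pt ->]]]; exists (u * v), (s ++ t); split.
  - by exists (x * y); rewrite mulrACA -ux -vy mulr1.
  - by move=> p; rewrite mem_cat => /orP [/ps|/pt].
  - by rewrite big_cat mulrACA.
move=> f; have [n] := ubnP (size f); elim: n => // n IHn in f *; rewrite ltnS => szf f0.
have [c [g [Ef c0 primg]]] := primitive_part f0.
have szg : size f = size g by rewrite Ef size_Cmul.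
have g0 : g != 0 by rewrite -size_poly_gt0 -szg size_poly_gt0.
rewrite Ef; apply: (mul); first exact: cst.
have [szg1|szg1] := leqP (size g) 1.
  by rewrite (size1_polyC szg1); apply: cst; rewrite -polyC_eq0 -size1_polyC.
case: (boolp.EM (forall h k, g = h * k -> (size h <= 1)%N \/ (size k <= 1)%N)) => [irr|].
  exists 1, [:: g]; split; first exact: divides_refl.
    by move=> p; rewrite inE => /eqP ->; apply: primitive_irreducible_prime.
  by rewrite big_seq1 mul1r.
move=> /boolp.existsNP [h /boolp.existsNP [k /boolp.not_implyP [Eg]]].
move=> /boolp.not_orP [/negP szh /negP szk]; rewrite -!ltnNge in szh szk.
have [h0 k0] : h != 0 /\ k != 0 by apply/andP; rewrite -negb_or -mulf_eq0 -Eg.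
rewrite Eg; move: szf; rewrite szg Eg size_mul // => szf.
by apply: (mul); apply: IHn => //; apply: leq_trans szf;
   case: (size h) szh (size k) szk => // [[|a]] // _ [|[|b]] // _;
   rewrite ?addnS ?addSn /= ltnS ?leq_addr ?leq_addl ?ltnS ?leq_addr ?leq_addl //.
Qed.

End FactorialPoly.

(** * Nullstellensatz for hypersurfaces *)

(** Elements of [R] are seen as functions on [T]. The notion is abstract so that an induction on the
    number of variables can pass through [{poly R}]. *)
Definition hypersurface_nullst (K : fieldType) (R : idomainType) (T : Type)
    (ev : T -> {rmorphism R -> K}) :=
  [/\ factorial_ring R, forall r, r != 0 -> exists x, ev x r != 0
    & forall p b, prime_elt p -> (forall x, ev x p = 0 -> ev x b = 0) -> divides p b].

Definition eval_poly_pt (K R : comNzRingType) (T : Type) (ev : T -> {rmorphism R -> K})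
    (x : T * K) : {rmorphism {poly R} -> K} :=
  horner_eval x.2 \o map_poly (ev x.1).

Section Nullst.
Variables (K : closedFieldType).

(** A nonconstant [q] takes the value 1, at a root of [q - 1]. *)
Lemma poly_nonvanishing (q : {poly K}) : q != 0 -> exists s, q.[s] != 0.
Proof.
move=> q0; have [/eqP sz1|sz1] := boolP (size q == 1).
  exists 0; move/eqP: sz1 => /size_poly1P [c c0 ->]; by rewrite hornerC.
have szq : (1 < size q)%N by rewrite ltn_neqAle eq_sym sz1 size_poly_gt0.
have /closed_rootP [s] : size (q - 1) != 1.
  by rewrite size_polyDl // size_polyN size_poly1.
by rewrite /root !hornerE subr_eq0 => /eqP Es; exists s; rewrite Es oner_neq0.
Qed.

(** A prime [p] of size at most 1 is treated coefficient by coefficient. Otherwise let [e] be the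
    pseudo-gcd of [p] and [b]: the prime [p] divides [q1 * e], which leaves two cases. *)
Lemma hypersurface_nullst_poly (R : idomainType) (T : Type)
    (ev : T -> {rmorphism R -> K}) :
  hypersurface_nullst ev -> hypersurface_nullst (eval_poly_pt ev).
Proof.
move=> [factR nv ns]; split; first exact: factorial_poly.
  move=> f f0; have := nv (lead_coef f); rewrite lead_coef_eq0 => /(_ f0) [x lx].
  have [|s fs] := @poly_nonvanishing (map_poly (ev x) f); last by exists (x, s).
  by rewrite -lead_coef_eq0 lead_coef_map_eq.
move=> p b pp Hz; have [p0 p1 pM] := pp.
have [szp|szp] := leqP (size p) 1.
  have Ep := size1_polyC szp; set c := p`_0 in Ep.
  have pc : prime_elt c.
    split; first by rewrite -polyC_eq0 -Ep.
      by move=> /divides_polyC; rewrite -Ep => /p1.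
    move=> u v /divides_polyC; rewrite polyCM -Ep => /pM.
    by rewrite Ep => -[] /(divides_polyC_coef 0); rewrite coefC /=; [left|right].
  have dc i : exists q, b`_i = q * c.
    apply: ns => // x xc; rewrite -coef_map.
    suff -> : map_poly (ev x) b = 0 by rewrite coef0.
    apply/eqP; apply: contraT => /poly_nonvanishing [s].
    have := Hz (x, s); rewrite /eval_poly_pt /= /horner_eval => ->; first by rewrite eqxx.
    by rewrite Ep map_polyC hornerC.
  have [f Hf] := boolp.choice dc.
  exists (\poly_(i < size b) f i); apply/polyP => i; rewrite Ep coefMC coef_poly.
  case: ltnP => [_|/leq_sizeP]; first exact: Hf.
  by move=> ->; rewrite ?mul0r.
have [e [a [b' [c1 [q1 [c2 [q2 [e0 Ee [c10 E1] [c20 E2]]]]]]]]] := pseudo_gcd b p0.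
have : divides p (q1 * e) by exists c1%:P.
case/pM => [[q Eq]|[w Ew]].
(* Here [e] is a constant [r]. Over a point where neither [r] nor the leading coefficient of [p]
   vanishes, [p] has a root, and there the Bezout relation makes [r] vanish. *)
- have Ec : c1%:P = q * e.
    by apply: (mulIf p0); rewrite E1 Eq mulrAC.
  have q0 : q != 0 by apply: contraNneq c10 => q0; rewrite -polyC_eq0 Ec q0 mul0r.
  have sze : (size e <= 1)%N.
    have := congr1 (fun q : {poly R} => size q) Ec.
    rewrite size_polyC c10 size_mul //=; move: q0; rewrite -(size_poly_gt0 q).
    by case: (size q) => // m _; rewrite addSn /= => E; rewrite E leq_addl.
  have Er := size1_polyC sze; set r := e`_0 in Er.
  have r0 : r != 0 by rewrite -polyC_eq0 -Er.
  have [|x] := nv (r * lead_coef p); first by rewrite mulf_neq0 // lead_coef_eq0.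
  rewrite rmorphM mulf_eq0 negb_or => /andP [xr xl].
  have /closed_rootP [s ps] : size (map_poly (ev x) p) != 1.
    by rewrite size_map_poly_id0 // neq_ltn szp orbT.
  have zp : eval_poly_pt ev (x, s) p = 0 by apply/eqP.
  have := congr1 (eval_poly_pt ev (x, s)) Ee.
  rewrite rmorphD !rmorphM zp (Hz _ zp) !mulr0 addr0 Er /=.
  by rewrite /horner_eval map_polyC hornerC => /eqP; rewrite (negPf xr).
- have : divides p (c2%:P * b) by exists (q2 * w); rewrite -mulrA -Ew.
  case/pM => [[z Ez]|//].
  have z0 : z != 0 by apply: contraNneq c20 => z0; rewrite -polyC_eq0 Ez z0 mul0r.
  have := congr1 (fun q : {poly R} => size q) Ez.
  rewrite size_polyC c20 size_mul //=; move: z0 szp; rewrite -(size_poly_gt0 z).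
  by case: (size z) (size p) => // m [|[|n]] //; rewrite addSn !addnS.
Qed.

Lemma hypersurface_nullst_iso (R R' : idomainType) (T T' : Type)
    (ev : T -> {rmorphism R -> K}) (ev' : T' -> {rmorphism R' -> K})
    (phi : {rmorphism R' -> R}) :
  injective phi -> (forall r, exists r', phi r' = r) ->
  (forall x, exists x', forall r, ev x (phi r) = ev' x' r) ->
  (forall x', exists x, forall r, ev x (phi r) = ev' x' r) ->
  hypersurface_nullst ev -> hypersurface_nullst ev'.
Proof.
move=> inj surj lr rl [factR nv ns].
have phi0 r : (phi r == 0) = (r == 0) by rewrite -(inj_eq inj) rmorph0.
have dE a b : divides (phi a) (phi b) <-> divides a b.
  split=> [[c]|[c ->]]; last by exists (phi c); rewrite rmorphM.
  by have [c' <-] := surj c; rewrite -rmorphM => /inj ->; exists c'.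
have pE p : prime_elt (phi p) <-> prime_elt p.
  split=> -[p0 p1 pM]; split.
  - by rewrite -phi0.
  - by move=> /dE; rewrite rmorph1.
  - by move=> a b /dE; rewrite rmorphM => /pM [] /dE; [left|right].
  - by rewrite phi0.
  - by rewrite -(rmorph1 phi) => /dE.
  - move=> a b; have [a' <-] := surj a; have [b' <-] := surj b.
    by rewrite -rmorphM => /dE /pM [] /dE; [left|right].
split.
- move=> a; rewrite -phi0 => /factR [u [s [u1 ps E]]].
  have [psi psiK] := boolp.choice surj.
  exists (psi u), (map psi s); split.
  + by apply/dE; rewrite psiK rmorph1.
  + by move=> p /mapP [q qs ->]; apply/pE; rewrite psiK; apply: ps.
  + apply: inj; rewrite E rmorphM psiK rmorph_prod big_map.
    by congr (_ * _); apply: eq_bigr => i _; rewrite psiK.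
- move=> r; rewrite -phi0 => /nv [x]; have [x' Ex] := lr x.
  by rewrite Ex; exists x'.
- move=> p b /pE pp H; apply/dE; apply: ns => // x.
  by have [x' Ex] := lr x; rewrite !Ex; apply: H.
Qed.

End Nullst.

Section RMorphEq.
Variable R : comNzRingType.

Lemma mpoly_rmorph_eq (S : comNzRingType) (m : nat) (f g : {rmorphism {mpoly R[m]} -> S}) :
  (forall c, f c%:MP = g c%:MP) -> (forall i, f 'X_i = g 'X_i) -> f =1 g.
Proof.
move=> Hc HX p; rewrite (mpolyE p) !rmorph_sum; apply: eq_bigr => k _.
rewrite -mul_mpolyC !rmorphM Hc; congr (_ * _).
by rewrite mpolyXE_id !rmorph_prod; apply: eq_bigr => i _; rewrite !rmorphXn /= HX.
Qed.

Lemma poly_rmorph_eq (S : comNzRingType) (f g : {rmorphism {poly R} -> S}) :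
  (forall c, f c%:P = g c%:P) -> f 'X = g 'X -> f =1 g.
Proof.
move=> Hc HX; elim/poly_ind => [|p c IH]; first by rewrite !rmorph0.
by rewrite !rmorphD !rmorphM IH HX Hc.
Qed.

End RMorphEq.

(** * Separating the last variable of a polynomial *)

Section Muni.
Variables (R : comNzRingType) (n : nat).

Lemma muni_widen i : muni ('X_(widen_ord (leqnSn n) i) : {mpoly R[n.+1]}) = ('X_i)%:P.
Proof.
rewrite muniE msuppX big_seq1 mcoeffX eqxx scale1r mnm1E.
rewrite -val_eqE /= ltn_eqF ?ltn_ord // expr0 alg_polyC; congr ('X_[_])%:P.
by apply/mnmP => j; rewrite mnmE !mnm1E -!val_eqE.
Qed.

Lemma muni_max : muni ('X_ord_max : {mpoly R[n.+1]}) = 'X.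
Proof.
rewrite muniE msuppX big_seq1 mcoeffX eqxx scale1r mnm1E eqxx expr1.
rewrite (_ : [multinom _ | _ < _] = 0%MM) ?mpolyX0 ?scale1r //.
by apply/mnmP => j; rewrite mnmE mnm1E mnm0E -val_eqE /= gtn_eqF ?ltn_ord.
Qed.

Definition mpoly_of_uni : {rmorphism {poly {mpoly R[n]}} -> {mpoly R[n.+1]}} :=
  horner_eval 'X_ord_max \o map_poly (@mwiden n R).

Lemma ord_max_or_widen (i : 'I_n.+1) : i = ord_max \/ exists j, i = widen_ord (leqnSn n) j.
Proof.
case: (ltnP i n) => [lt_in|le_ni]; [right|left].
  by exists (Ordinal lt_in); apply: val_inj.
by apply: val_inj => /=; apply/eqP; rewrite eqn_leq le_ni -ltnS ltn_ord.
Qed.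

Lemma muniK : cancel (@muni n R) mpoly_of_uni.
Proof.
move=> p; rewrite -[RHS]/(idfun p); move: p.
apply: (mpoly_rmorph_eq (f := mpoly_of_uni \o @muni n R) (g := idfun)) => [c|i] /=.
  by rewrite /mpoly_of_uni /= /horner_eval muniC map_polyC hornerC /= mwidenC.
rewrite /mpoly_of_uni /= /horner_eval; case: (ord_max_or_widen i) => [->|[j ->]].
  by rewrite muni_max map_polyX hornerX.
by rewrite muni_widen map_polyC hornerC /= mwidenX mnmwiden1.
Qed.

Lemma mpoly_of_uniK : cancel mpoly_of_uni (@muni n R).
Proof.
move=> p; rewrite -[RHS]/(idfun p); move: p.
apply: (poly_rmorph_eq (f := @muni n R \o mpoly_of_uni) (g := idfun)) => [c|] /=.
  rewrite /mpoly_of_uni /= /horner_eval map_polyC hornerC /=; move: c.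
  apply: (mpoly_rmorph_eq (f := @muni n R \o @mwiden n R) (g := @polyC _)) => [c|i] /=.
    by rewrite mwidenC muniC.
  by rewrite mwidenX mnmwiden1 muni_widen.
by rewrite /mpoly_of_uni /= /horner_eval map_polyX hornerX muni_max.
Qed.

End Muni.

(** Induction on [n], the last variable being separated by [muni]. Without variables every nonzero
    element is a unit, so there are no primes. *)
Lemma mpoly_nullst (K : closedFieldType) (n : nat) :
  hypersurface_nullst (fun v : 'I_n -> K => meval v : {rmorphism {mpoly K[n]} -> K}).
Proof.
elim: n => [|n IHn].
  have cst (a : {mpoly K[0]}) : a = (a@_0)%:MP by apply: nvar0_mpolyC.
  have unit (a : {mpoly K[0]}) : a != 0 -> divides a 1.
    move=> a0; exists (a@_0)^-1%:MP; rewrite {2}[a]cst -mpolyCM mulVf //.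
    by rewrite -(mpolyC_eq0 0) -cst.
  split=> [a a0|r r0|p b [p0 p1 _]]; last by case: p1; apply: unit.
    exists a, [::]; split => //; first exact: unit.
    by rewrite big_nil mulr1.
  exists (fun=> 0); have E : r.@[fun=> 0] = r@_0 by rewrite {1}[r]cst mevalC.
  suff : r@_0 != 0 by rewrite -E.
  by rewrite -(mpolyC_eq0 0) -cst.
apply: (hypersurface_nullst_iso (phi := @muni n K) _ _ _ _ (hypersurface_nullst_poly IHn)).
- exact: can_inj (@muniK _ _).
- by move=> r; exists (mpoly_of_uni K n r); apply: mpoly_of_uniK.
- move=> [v s]; pose w (i : 'I_n.+1) := if unlift ord_max i is Some j then v j else s.
  exists w; apply: (mpoly_rmorph_eq (g := meval w) (f := eval_poly_pt
    (fun v : 'I_n -> K => meval v : {rmorphism _ -> _}) (v, s) \o @muni n K)) => [c|i] /=.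
    by rewrite muniC /eval_poly_pt /= /horner_eval map_polyC hornerC /= !mevalC.
  rewrite /eval_poly_pt /= /horner_eval mevalXU /w; case: (ord_max_or_widen i) => [->|[j ->]].
    by rewrite muni_max map_polyX hornerX unlift_none.
  rewrite muni_widen map_polyC hornerC /= mevalXU.
  have -> : widen_ord (leqnSn n) j = lift ord_max j.
    by apply: val_inj; rewrite /= /bump leqNgt ltn_ord.
  by rewrite liftK.
- move=> w; exists (fun j => w (widen_ord (leqnSn n) j), w ord_max).
  apply: (mpoly_rmorph_eq (g := meval w) (f := eval_poly_pt
    (fun v : 'I_n -> K => meval v : {rmorphism _ -> _}) _ \o @muni n K)) => [c|i] /=.
    by rewrite muniC /eval_poly_pt /= /horner_eval map_polyC hornerC /= !mevalC.
  rewrite /eval_poly_pt /= /horner_eval mevalXU; case: (ord_max_or_widen i) => [->|[j ->]].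
    by rewrite muni_max map_polyX hornerX.
  by rewrite muni_widen map_polyC hornerC /= mevalXU.
Qed.

(** * Multiplicities along a derivation *)

Section PrimePowers.
Variable R : idomainType.
Implicit Types (a b p q : R).

Lemma prime_power_cancel p a b n : prime_elt p -> ~ divides p a ->
  divides (p ^+ n) (a * b) -> divides (p ^+ n) b.
Proof.
move=> [p0 p1 pM] npa; elim: n b => [|n IHn] b.
  by move=> _; exists b; rewrite expr0 mulr1.
move=> [c E]; have : divides p (a * b) by exists (c * p ^+ n); rewrite E exprS; ring.
case/pM => // [[b' Eb]]; have [|e Ee] := IHn b'.
  exists c; apply: (mulIf p0); rewrite -mulrA -Eb E exprS; ring.
by exists e; rewrite Eb Ee exprS; ring.
Qed.

(** Induction on the prime factors of [a]: one of them is removed from both [a] and [b], which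
    lowers the exponents of its associates by one and leaves the others unchanged. *)
Lemma factorial_dividesP a b : factorial_ring R -> a != 0 ->
  (forall p n, prime_elt p -> divides (p ^+ n) a -> divides (p ^+ n) b) -> divides a b.
Proof.
move=> factR /factR [u [s [u1 ps ->]]].
elim: s ps b => [|p s IHs] ps b H.
  by rewrite big_nil mulr1; apply: divides_unit.
have pp : prime_elt p by apply: ps; rewrite mem_head.
have [p0 p1 pM] := pp.
have [b' Eb] : divides p b.
  rewrite -[p]expr1; apply: H => //; rewrite expr1 big_cons mulrCA.
  exact/divides_mulr/divides_refl.
have [|q n pq dq|c Ec] := IHs _ b'.
- by move=> r rs; apply: ps; rewrite inE rs orbT.
- have [q0 q1 qM] := pq.
  case: (boolp.EM (divides q p)) => [dqp|ndqp].
    have [v v1 Ep] := prime_assoc pq pp dqp.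
    have v0 : v != 0 by apply: contraNneq p0 => v0; rewrite Ep v0 mul0r.
    have [|c Ec] := H q n.+1 pq.
      case: dq => c Ec; exists (c * v).
      by rewrite big_cons mulrCA Ec Ep exprS; ring.
    case: v1 => w Ew; exists (w * c); apply: (mulIf p0); rewrite -Eb Ec exprS Ep.
    by transitivity ((w * v) * c * (q * q ^+ n)); [rewrite -Ew; ring | ring].
  apply: (prime_power_cancel pq ndqp); rewrite mulrC -Eb; apply: H => //.
  by rewrite big_cons mulrCA; apply: divides_mull.
- by exists c; rewrite Eb Ec big_cons; ring.
Qed.

End PrimePowers.

Lemma divides_rmorph (R S : idomainType) (f : {rmorphism R -> S}) a b :
  divides a b -> divides (f a) (f b).
Proof. by move=> [c ->]; exists (f c); rewrite rmorphM. Qed.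

Lemma size_divides_monom (K : fieldType) (p : {poly K}) (n : nat) :
  divides p 'X^n -> exists c e, [/\ c != 0, p = c *: 'X^e & (e <= n)%N].
Proof.
move=> [q E]; have : p %| ('X - 0%:P) ^+ n by rewrite subr0 E dvdp_mull.
case/dvdp_exp_XsubCP => e le_en; rewrite subr0 => /eqpf_eq [c c0 ->].
by exists c, e.
Qed.

(** * A derivation criterion for being a [d]-th power *)

Section PrimePowerCriterion.
Variables (K : fieldType) (A : idomainType) (phi : {rmorphism A -> {poly K}}).
Variables (D : A -> A) (F : A) (d : nat) (c1 c2 : K).
Hypothesis factA : factorial_ring A.
Hypothesis d_gt0 : (0 < d)%N.
Hypothesis natA : forall m, (0 < m <= d)%N -> divides (m%:R : A) 1.
Hypothesis natK : forall m, (0 < m <= d)%N -> (m%:R : K) != 0.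
Hypothesis DM : forall a b, D (a * b) = a * D b + b * D a.
Hypothesis c10 : c1 != 0.
Hypothesis c20 : c2 != 0.
Hypothesis phiF : phi F = 'X^d.
Hypothesis phiDF : phi (D F) = c1 *: 'X^(d.-1).
Hypothesis phiD : forall a, phi (D a) = c2 *: (phi a)^`().
Hypothesis primeDF : forall p, prime_elt p -> divides p (D F) ->
  (1 < size (phi p))%N -> divides p F.

Lemma derivation_exp a m : D (a ^+ m.+1) = m.+1%:R * a ^+ m * D a.
Proof.
elim: m => [|m IHm]; first by rewrite expr0 mulr1 mul1r expr1.
by rewrite exprS DM IHm exprS -[m.+2%:R]natr1; ring.
Qed.

Lemma phi_F_neq0 : phi F != 0.
Proof. by rewrite phiF monic_neq0 // monicXn. Qed.

Lemma phi_divisor_neq0 a b : divides a b -> phi b != 0 -> phi a != 0.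
Proof. by move=> [c ->]; rewrite rmorphM mulf_eq0 negb_or => /andP []. Qed.

Lemma phi_unit u : divides u 1 -> size (phi u) = 1%N.
Proof.
move=> [v E]; apply/eqP; rewrite -/(size (phi u) == 1)%N.
have := divides_rmorph phi (ex_intro _ v E); rewrite rmorph1 => -[w Ew].
by rewrite -dvdp1 Ew dvdp_mull.
Qed.

Lemma phi_size_prod (s : seq A) (P : pred A) :
  (forall a, a \in s -> P a -> size (phi a) = 1%N) ->
  size (phi (\prod_(a <- s | P a) a)) = 1%N.
Proof.
elim: s => [|a s IHs] H; first by rewrite big_nil rmorph1 size_poly1.
rewrite big_cons; case: ifP => Pa; last first.
  by apply: IHs => b bs; apply: H; rewrite inE bs orbT.
have [k k0 Ek] : exists2 k, k != 0 & phi a = k%:P.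
  by apply/size_poly1P; rewrite H ?mem_head.
rewrite rmorphM Ek mul_polyC size_scale //; apply: IHs => b bs.
by apply: H; rewrite inE bs orbT.
Qed.

Lemma prime_multiplicity p a : prime_elt p -> (1 < size (phi p))%N -> phi a != 0 ->
  exists m b, a = p ^+ m * b /\ ~ divides p b.
Proof.
move=> pp szp; have [n] := ubnP (size (phi a)).
elim: n => // n IHn in a *; rewrite ltnS => sza a0.
case: (boolp.EM (divides p a)) => [[b Eb]|npa]; last first.
  by exists 0%N, a; rewrite expr0 mul1r.
have b0 : phi b != 0 by move: a0; rewrite Eb rmorphM mulf_eq0 negb_or => /andP [].
have [||m [e [Ee npe]]] := IHn b => //.
  apply: leq_trans sza; rewrite Eb rmorphM size_mul //; last first.
    by rewrite -size_poly_gt0 ltnW.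
  by case: (size (phi p)) szp => [|[|k]] // _; rewrite !addnS /= ltnS leq_addr.
by exists m.+1, e; split => //; rewrite Eb Ee exprS; ring.
Qed.

(** The image of [p] divides ['X^d], so it is a monomial of degree [e] with [0 < e <= d]; as [e] is
    nonzero in [K], its derivative is nonzero of smaller degree. *)
Lemma prime_ndivides_deriv p : prime_elt p -> divides p F -> (1 < size (phi p))%N ->
  ~ divides p (D p).
Proof.
move=> pp dpF szp /(divides_rmorph phi); rewrite phiD.
have /size_divides_monom [k [e [k0 Ep le_ed]]] : divides (phi p) 'X^d.
  by rewrite -phiF; apply: divides_rmorph.
have e0 : (0 < e)%N.
  by move: szp; rewrite Ep size_scale // size_polyXn; case: e {Ep le_ed}.
move=> [q]; rewrite Ep derivZ derivXn => E.
have szE : size (c2 *: (k *: ('X^(e.-1) *+ e))) = e.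
  rewrite -scaler_nat !size_scale ?size_polyXn ?prednK ?natK ?e0 //.
have q0 : q != 0.
  by apply: contraTneq e0 => q0; rewrite -szE E q0 mul0r size_poly0.
have := congr1 (fun q : {poly K} => size q) E; rewrite /= szE.
rewrite size_mul ?q0 // ?scaler_eq0 ?negb_or ?k0 ?monic_neq0 ?monicXn //.
rewrite size_scale // size_polyXn; move: q0; rewrite -(size_poly_gt0 q).
by lia.
Qed.

(** By Leibniz, modulo [p ^+ m.+1] the derivative of [F] is [m.+1] times [p ^+ m * b * D p]. Degrees
    give [m.+1 <= d], so the integer factor is a unit, and [p] divides neither [b] nor [D p]. *)
Lemma prime_mult_deriv p m b : prime_elt p -> (1 < size (phi p))%N ->
  F = p ^+ m.+1 * b -> ~ divides p b -> ~ divides (p ^+ m.+1) (D F).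
Proof.
move=> pp szp EF npb; have [p0 p1 pM] := pp.
have dpF : divides p F by exists (p ^+ m * b); rewrite EF exprS; ring.
have le_md : (m.+1 <= d)%N.
  have : phi F = phi p ^+ m.+1 * phi b by rewrite EF rmorphM rmorphXn.
  move=> E; have := phi_F_neq0; rewrite E mulf_eq0 negb_or => /andP [pm0 b0].
  have := congr1 (fun q : {poly K} => size q) E; rewrite /= phiF size_polyXn size_mul //.
  have := size_exp (phi p) m.+1; move: b0; rewrite -(size_poly_gt0 (phi b)).
  have szp1 : (0 < (size (phi p)).-1)%N by move: szp; lia.
  have := leq_pmull m.+1 szp1.
  move: pm0; rewrite -(size_poly_gt0 (_ ^+ _)).
  by move: (size (phi p ^+ m.+1)) (size (phi b)) (_ * _)%N => x y z; lia.
rewrite EF DM derivation_exp => H.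
have : divides (p ^+ m.+1) (b * (m.+1%:R * p ^+ m * D p)).
  apply: (@divides_subl _ _ _ (p ^+ m.+1 * D b)); first by rewrite addrC.
  exact/divides_mulr/divides_refl.
move=> [c Ec]; have : divides p (m.+1%:R * (b * D p)).
  exists c; apply: (@mulIf _ (p ^+ m)); first by rewrite expf_neq0.
  transitivity (b * (m.+1%:R * p ^+ m * D p)); first by ring.
  by rewrite Ec exprS; ring.
case/pM=> [dpm|/pM [//|]]; last exact: prime_ndivides_deriv.
by apply: p1; apply: divides_trans dpm (natA _); rewrite le_md.
Qed.

(** To be applied with [F] a component of the map, [phi] the restriction to a line at infinity, and
    [D] a derivation sending [F] to the affine Jacobian. *)
Lemma prime_power_criterion : exists p q, F = p ^+ d * q /\ size (phi p) = 2%N.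
Proof.
have F0 : F != 0 by apply: contraNneq phi_F_neq0 => ->; rewrite rmorph0.
have phiJ0 : phi (D F) != 0.
  by rewrite phiDF scaler_eq0 negb_or c10 monic_neq0 // monicXn.
have J0 : D F != 0 by apply: contraNneq phiJ0 => ->; rewrite rmorph0.
have [u [t [u1 pt EJ]]] := factA J0.
(* [T] collects the prime factors of [D F] with nonconstant image, so that [phi T] has the full
   degree [d - 1] of [phi (D F)]. *)
pose T := \prod_(a <- t | (1 < size (phi a))%N) a.
pose T' := u * \prod_(a <- t | ~~ (1 < size (phi a))%N) a.
have EJT : D F = T * T' by rewrite EJ (bigID (fun a => 1 < size (phi a))%N) /= mulrCA.
have szT' : size (phi T') = 1%N.
  have [k k0 Ek] : exists2 k, k != 0 & phi u = k%:P.
    by apply/size_poly1P; rewrite phi_unit.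
  rewrite rmorphM Ek mul_polyC size_scale //; apply: phi_size_prod => a at_.
  rewrite -leqNgt => sza; apply/eqP; rewrite eqn_leq sza size_poly_gt0.
  apply: phi_divisor_neq0 phiJ0; rewrite EJ; apply: divides_mull.
  by rewrite (big_rem a at_) /=; apply/divides_mulr/divides_refl.
have phiT0 : phi T != 0 by apply: phi_divisor_neq0 phiJ0; rewrite EJT; apply/divides_mulr/divides_refl.
have szT : size (phi T) = d.
  have := congr1 (fun q => size (phi q)) EJT; rewrite /= phiDF rmorphM size_scale //.
  rewrite size_polyXn size_mul // ?szT' ?addn1 ?prednK //.
  by rewrite -size_poly_gt0 szT'.
have T0 : T != 0 by apply: contraNneq phiT0 => ->; rewrite rmorph0.
(* A prime with nonconstant image that divides [T] divides [F] by [primeDF], and its exponent in [F]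
   exceeds its exponent in [D F]. So [F] has room for [T] and one more prime factor. *)
have key p : prime_elt p -> divides p F -> divides (T * p) F.
  move=> pp dpF; have [p0 p1 pM] := pp.
  apply: factorial_dividesP => //; first by rewrite mulf_neq0.
  move=> r n pr; have [r0 r1 rM] := pr.
  case: n => [|n]; first by move=> _; exists F; rewrite expr0 mulr1.
  have [szr|szr] := leqP (size (phi r)) 1.
    have nrT : ~ divides r T.
      rewrite /T -big_filter => /(prime_divides_prod pr) [a].
      rewrite mem_filter => /andP [sza at_] /(prime_assoc pr (pt _ at_)) [v v1 Ea].
      move: sza; rewrite Ea rmorphM.
      have [k k0 ->] : exists2 k, k != 0 & phi v = k%:P.
        by apply/size_poly1P; rewrite phi_unit.
      by rewrite mul_polyC size_scale // ltnNge szr.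
    move=> /(prime_power_cancel pr nrT) dr.
    exact: divides_trans dr dpF.
  have [m [b [EF nrb]]] := prime_multiplicity pr szr phi_F_neq0.
  have dT m' : divides (r ^+ m') T -> divides (r ^+ m') (D F).
    by rewrite EJT; apply: divides_mulr.
  case: m EF => [|m] EF.
    have nrF : ~ divides r F by rewrite EF expr0 mul1r.
    move=> [c Ec]; have : divides r (T * p) by exists (c * r ^+ n); rewrite Ec exprS; ring.
    case/rM => [drT|/(prime_assoc pr pp) [v v1 Ep]].
      case: nrF; apply: primeDF => //.
      by rewrite EJT; apply: divides_mulr.
    by case: nrF; apply: divides_trans dpF; exists v.
  have nJ := prime_mult_deriv pr szr EF nrb.
  case=> c Ec.
  have drn : divides (r ^+ n) T.
    case: (boolp.EM (divides r p)) => [/(prime_assoc pr pp) [v [w Ew] Ep]|nrp].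
      exists (w * c); apply: (mulIf p0); rewrite Ec Ep exprS.
      by transitivity ((w * v) * c * (r * r ^+ n)); [rewrite -Ew; ring | ring].
    apply: (prime_power_cancel pr nrp); exists (c * r); rewrite mulrC Ec exprS; ring.
  have [le_nm|lt_mn] := leqP n m.
    exists (r ^+ (m - n) * b); rewrite EF -(subnK (_ : n.+1 <= m.+1)%N) //.
    by rewrite subSS exprD; ring.
  case: nJ; apply: dT; case: drn => e Ee.
  by exists (e * r ^+ (n - m.+1)); rewrite Ee -mulrA -exprD subnK.
(* As [phi T] already accounts for degree [d - 1] out of [d], the image of [p] is linear and that of
   [q] constant. *)
have key2 p : prime_elt p -> divides p F -> (1 < size (phi p))%N ->
    exists q, [/\ F = T * p * q, size (phi p) = 2%N & size (phi q) = 1%N].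
  move=> pp dpF szp; have [q Eq] := key p pp dpF.
  exists q; have EF : F = T * p * q by rewrite Eq mulrC.
  have phip0 : phi p != 0 by rewrite -size_poly_gt0 ltnW.
  have phiq0 : phi q != 0.
    by apply: phi_divisor_neq0 phi_F_neq0; rewrite EF; apply/divides_mull/divides_refl.
  have := congr1 (fun q => size (phi q)) EF; rewrite /= phiF !rmorphM size_polyXn.
  rewrite !size_mul ?mulf_neq0 // szT; move: phiq0; rewrite -(size_poly_gt0 (phi q)).
  move: szp; move: (size (phi p)) (size (phi q)) => x y x1 y0 xy.
  by split => //; lia.
have [v [s [v1 ps EF]]] := factA F0.
have szv := phi_unit v1.
have dsF p : p \in s -> divides p F.
  by move=> pins; rewrite EF (big_rem p pins) /= mulrCA; apply/divides_mulr/divides_refl.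
have [p pins szp] : exists2 p, p \in s & (1 < size (phi p))%N.
  apply: boolp.contrapT => H; have : size (phi F) = 1%N.
    have [k k0 Ek] : exists2 k, k != 0 & phi v = k%:P by apply/size_poly1P; rewrite szv.
    rewrite EF rmorphM Ek mul_polyC size_scale //; apply: phi_size_prod => a at_ _.
    apply/eqP; rewrite eqn_leq size_poly_gt0 leqNgt; apply/andP; split.
      by apply/negP => sza; apply: H; exists a.
    exact: phi_divisor_neq0 (dsF _ at_) phi_F_neq0.
  by rewrite phiF size_polyXn; case: d d_gt0.
have pp := ps _ pins; have [q [EFq szp2 szq]] := key2 p pp (dsF _ pins) szp.
(* Comparing [F = T * p * q] with [F = T * r * q'] shows that [r] divides [p * q]; it cannot divide
   [q], whose image is constant. *)
have assoc r : r \in s -> (1 < size (phi r))%N -> exists2 w, divides w 1 & r = w * p.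
  move=> rs szr; have pr := ps _ rs.
  have [q' [EFq' _ _]] := key2 r pr (dsF _ rs) szr.
  have [r0 r1 rM] := pr.
  have : divides r (p * q).
    by exists q'; apply: (mulfI T0); rewrite mulrA -EFq EFq'; ring.
  case/rM=> [drp|drq].
    apply: (prime_assoc pp pr).
    have [w [x Ex] ->] := prime_assoc pr pp drp.
    by exists x; rewrite mulrA -Ex mul1r.
  have phiq0 : phi q != 0 by rewrite -size_poly_gt0 szq.
  have := divides_rmorph phi drq => -[y Ey].
  have : (size (phi r) <= size (phi q))%N.
    by apply: dvdp_leq => //; rewrite Ey dvdp_mull.
  by rewrite szq leqNgt szr.
have [k [e [Ee sze]]] : exists k e, \prod_(r <- s) r = p ^+ k * e /\ size (phi e) = 1%N.
  have: forall r, r \in s -> (exists2 w, divides w 1 & r = w * p) \/ size (phi r) = 1%N.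
    move=> r rs; have [szr|szr] := leqP (size (phi r)) 1; last by left; apply: assoc.
    right; apply/eqP; rewrite eqn_leq szr size_poly_gt0.
    exact: phi_divisor_neq0 (dsF _ rs) phi_F_neq0.
  elim: (s) => [|r s' IHs] H.
    by exists 0%N, 1; rewrite big_nil expr0 mulr1 rmorph1 size_poly1.
  have [|k [e [Ee sze]]] := IHs; first by move=> x xs; apply: H; rewrite inE xs orbT.
  have mulC1 x : size (phi x) = 1%N -> size (phi (x * e)) = 1%N.
    move=> szx; have [l l0 El] : exists2 l, l != 0 & phi x = l%:P.
      by apply/size_poly1P; rewrite szx.
    by rewrite rmorphM El mul_polyC size_scale.
  case: (H r (mem_head _ _)) => [[w w1 Er]|szr].
    exists k.+1, (w * e); split; first by rewrite big_cons Ee Er exprS; ring.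
    exact/mulC1/phi_unit.
  exists k, (r * e); split; first by rewrite big_cons Ee; ring.
  exact: mulC1.
exists p, (v * e); split => //.
(* Up to a factor with constant image, [F] is now a power of [p]; the degree of [phi F] determines
   the exponent. *)
suff <- : k = d by rewrite EF Ee; ring.
have := congr1 (fun q => size (phi q)) EF; rewrite /= phiF size_polyXn Ee.
have [l l0 El] : exists2 l, l != 0 & phi v = l%:P by apply/size_poly1P; rewrite szv.
have [l' l'0 El'] : exists2 l, l != 0 & phi e = l%:P by apply/size_poly1P; rewrite sze.
rewrite !rmorphM El El' rmorphXn mul_polyC size_scale // mulrC mul_polyC size_scale //.
have phip0 : phi p != 0 by rewrite -size_poly_gt0 szp2.
have := size_exp (phi p) k; rewrite szp2 /=.
have : (0 < size (phi p ^+ k))%N by rewrite size_poly_gt0 expf_neq0.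
by move: (size _) => x; rewrite mul1n => x_gt0 <- Ed; rewrite -Ed.
Qed.

End PrimePowerCriterion.

(** * Rigidity of the reduced map *)

Lemma mpoly_ring_ind (R : comNzRingType) (n : nat) (P : {mpoly R[n]} -> Prop) :
  (forall c, P c%:MP) -> (forall i, P 'X_i) ->
  (forall p q, P p -> P q -> P (p + q)) -> (forall p q, P p -> P q -> P (p * q)) ->
  forall p, P p.
Proof.
move=> PC PX PD PM p; rewrite (mpolyE p).
apply: big_rec => [|m q _ Pq]; first by rewrite -mpolyC0.
apply: PD => //; rewrite -mul_mpolyC; apply: (PM) => //; rewrite mpolyXE_id.
apply: big_rec => [|i r _ Pr]; first by rewrite -mpolyC1.
apply: (PM) => //; elim: (m i) => [|e IHe]; first by rewrite expr0 -mpolyC1.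
by rewrite exprS; apply: PM.
Qed.

(** Both sides are derivations along [Phi] that vanish on constants, so they agree once they agree
    on the variables. *)
Lemma mpoly_chain_rule (R S : comNzRingType) (n : nat)
    (Phi : {rmorphism {mpoly R[n]} -> S}) (D : {mpoly R[n]} -> S) :
  (forall c, D c%:MP = 0) -> (forall p q, D (p + q) = D p + D q) ->
  (forall p q, D (p * q) = Phi p * D q + Phi q * D p) ->
  forall p, D p = \sum_i Phi (mderiv i p) * D 'X_i.
Proof.
move=> DC DD DM; apply: mpoly_ring_ind => [c|i|p q IHp IHq|p q IHp IHq].
- by rewrite DC big1 // => i _; rewrite mderivC rmorph0 mul0r.
- rewrite (bigD1 i) //= mderivX mnm1E eqxx scale1r.
  rewrite (_ : (U_(i) - U_(i))%MM = 0%MM) ?mpolyX0 ?rmorph1 ?mul1r; last first.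
    by apply/mnmP => j; rewrite mnmBE mnm0E subnn.
  rewrite big1 ?addr0 // => j ne_ji; rewrite mderivX mnm1E eq_sym (negPf ne_ji).
  by rewrite scale0r rmorph0 mul0r.
- rewrite DD IHp IHq -big_split; apply: eq_bigr => i _ /=.
  by rewrite mderivD rmorphD mulrDl.
- rewrite DM IHp IHq !mulr_sumr -big_split; apply: eq_bigr => i _ /=.
  by rewrite mderivM rmorphD !rmorphM; ring.
Qed.

Lemma mderiv_map_mpoly (R S : comNzRingType) (f : {rmorphism R -> S}) (n : nat)
    (i : 'I_n) (p : {mpoly R[n]}) :
  mderiv i (map_mpoly f p) = map_mpoly f (mderiv i p).
Proof.
by apply/mpolyP => m; rewrite mcoeff_deriv !mcoeff_map_mpoly mcoeff_deriv raddfMn.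
Qed.

Lemma mderivXU (R : comNzRingType) (n : nat) (i j : 'I_n) :
  mderiv i ('X_j : {mpoly R[n]}) = (i == j)%:R.
Proof.
rewrite mderivX mnm1E eq_sym; case: eqP => [->|_]; last by rewrite scale0r.
rewrite scale1r (_ : (U_(j) - U_(j))%MM = 0%MM) ?mpolyX0 //.
by apply/mnmP => k; rewrite mnmBE mnm0E subnn.
Qed.

Lemma mderiv_exp (R : comNzRingType) (n : nat) (i : 'I_n) (p : {mpoly R[n]}) (m : nat) :
  mderiv i (p ^+ m) = p ^+ m.-1 * mderiv i p *+ m.
Proof.
elim: m => [|m IHm]; first by rewrite expr0 -mpolyC1 mderivC mulr0n.
rewrite exprS mderivM IHm; case: m {IHm} => [|m] /=.
  by rewrite expr0 mulr0n !mulr1 mulr0 addr0 mul1r mulr1n.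
by rewrite [mderiv i p * _]mulrC mulrnAr mulrA -exprS -mulrS.
Qed.

Section MonicForm.
Variables (R : comNzRingType) (N d : nat).
Implicit Types (g : 'I_N -> {mpoly R[N.+1]}).

Definition affine_var (i : 'I_N) : 'I_N.+1 := lift ord_max i.

Definition monic_form g (i : 'I_N) : {mpoly R[N.+1]} :=
  'X_(affine_var i) ^+ d + 'X_ord_max * g i.

(** The derivatives are taken in the affine variables only, [x_N] being treated as a constant. *)
Definition affine_jacobian (f : 'I_N -> {mpoly R[N.+1]}) : 'M[{mpoly R[N.+1]}]_N :=
  \matrix_(i, j) mderiv (affine_var j) (f i).

Lemma affine_var_neq_max i : (affine_var i == ord_max) = false.
Proof. by apply: negPf; rewrite eq_sym neq_lift. Qed.

Lemma affine_var_eq i j : (affine_var i == affine_var j) = (i == j).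
Proof. by rewrite (inj_eq lift_inj). Qed.

Lemma affine_jacobian_monicE g i j :
  affine_jacobian (monic_form g) i j =
    ('X_(affine_var i) ^+ d.-1 *+ d) *+ (i == j) + 'X_ord_max * mderiv (affine_var j) (g i).
Proof.
rewrite mxE mderivD mderiv_exp mderivM !mderivXU affine_var_neq_max.
rewrite affine_var_eq mul0r add0r eq_sym.
by case: eqP => _; rewrite ?mulr1 // mulr0 mul0rn.
Qed.

Lemma monic_form_meval g i (x : 'I_N.+1 -> R) :
  (monic_form g i).@[x] = x (affine_var i) ^+ d + x ord_max * (g i).@[x].
Proof. by rewrite mevalD mevalM rmorphXn /= !mevalXU. Qed.

End MonicForm.

(** The only nonzero entry in the last row of the full Jacobian matrix is the derivative of [x_N^d];
    the determinant is expanded along that row. *)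
Lemma jacobian_monic (k : fieldType) (N d : nat) (g : 'I_N -> {mpoly k[N.+1]}) :
  jacobian_det (monic_poly_map d g) =
    ('X_ord_max ^+ d.-1 *+ d) * \det (affine_jacobian (monic_form d g)).
Proof.
rewrite /jacobian_det (expand_det_row _ ord_max) (bigD1 ord_max) //= big1 ?addr0; last first.
  move=> i ne_i; rewrite mxE /monic_poly_map unlift_none mderiv_exp mderivXU.
  by rewrite (negPf ne_i) mulr0 mul0rn mul0r.
rewrite mxE /monic_poly_map unlift_none mderiv_exp mderivXU eqxx mulr1; congr (_ * _).
rewrite /cofactor -signr_odd addnn odd_double expr0 mul1r; congr (\det _).
by apply/matrixP => i j; rewrite !mxE liftK.
Qed.

Section Rigidity.
Variables (K : closedFieldType) (N d : nat) (g : 'I_N -> {mpoly K[N.+1]}).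
Let f := monic_form d g.
Let M := affine_jacobian f.

Definition axis_point (j : 'I_N) (i : 'I_N.+1) : {poly K} :=
  if unlift ord_max i is Some l then (if l == j then 'X else 1) else 0.

(* Restriction to the line at infinity x_j = X, x_l = 1 (l <> j), x_N = 0. *)
Definition axis_eval (j : 'I_N) : {rmorphism {mpoly K[N.+1]} -> {poly K}} :=
  mmap (@polyC K) (axis_point j).

Lemma axis_evalX j i : axis_eval j 'X_i = axis_point j i.
Proof. by rewrite /axis_eval /= mmapX mmap1U. Qed.

Lemma axis_evalC j c : axis_eval j c%:MP = c%:P.
Proof. by rewrite /axis_eval /= mmapC. Qed.

Lemma axis_point_max j : axis_point j ord_max = 0.
Proof. by rewrite /axis_point unlift_none. Qed.

Lemma axis_point_affine j l : axis_point j (affine_var l) = if l == j then 'X else 1.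
Proof. by rewrite /axis_point liftK. Qed.

Lemma axis_eval_form j i : axis_eval j (f i) = if i == j then 'X^d else 1.
Proof.
rewrite rmorphD rmorphM rmorphXn /= !axis_evalX axis_point_max mul0r addr0.
by rewrite axis_point_affine; case: eqP => // _; rewrite expr1n.
Qed.

(** The determinant of [M] with row [j] replaced by the affine gradient of [p]. It is a derivation
    in [p], and its value at [f j] is [\det M]. *)
Definition jacobian_row (j : 'I_N) (p : {mpoly K[N.+1]}) :=
  \sum_l mderiv (affine_var l) p * cofactor M j l.

Lemma jacobian_row_form j : jacobian_row j (f j) = \det M.
Proof.
by rewrite (expand_det_row _ j); apply: eq_bigr => l _; rewrite [M j l]mxE.
Qed.

Lemma jacobian_rowM j p q :
  jacobian_row j (p * q) = p * jacobian_row j q + q * jacobian_row j p.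
Proof.
rewrite /jacobian_row !mulr_sumr -big_split; apply: eq_bigr => l _ /=.
by rewrite mderivM; ring.
Qed.

(** On [x_N = 0] the matrix [M] is diagonal, so the off-diagonal cofactors vanish, and the one at
    [(j, j)] is a product of [N - 1] entries equal to [d]. *)
Lemma axis_eval_cofactor j l :
  axis_eval j (cofactor M j l) = (d%:R ^+ N.-1 *+ (l == j))%:P.
Proof.
rewrite -cofactor_map_mx.
have -> : map_mx (axis_eval j) M =
    diag_mx (\row_i (if i == j then 'X^(d.-1) *+ d else d%:R)).
  apply/matrixP => a b; rewrite mxE affine_jacobian_monicE !mxE rmorphD rmorphM /=.
  rewrite axis_evalX axis_point_max mul0r addr0 eq_sym !rmorphMn /= rmorphXn /=.
  rewrite axis_evalX axis_point_affine; case: (a =P j) => // _.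
  by rewrite expr1n.
rewrite /cofactor; have [->|ne_lj] := eqVneq l j.
  rewrite -signr_odd addnn odd_double expr0 mul1r mulr1n.
  set v := \row_i _; have -> : row' j (col' j (diag_mx v)) = (d%:R)%:M.
    apply/matrixP => a b; rewrite !mxE (inj_eq lift_inj).
    by rewrite eq_sym (negPf (neq_lift _ _)).
  by rewrite det_scalar rmorphXn rmorph_nat.
rewrite mulr0n (_ : \det _ = 0) ?mulr0 ?polyC0 //.
have ne_jl : j != l by rewrite eq_sym.
have [l' El] : exists l', l = lift j l'.
  by case/unlift_some: ne_jl => l' El _; exists l'.
rewrite (expand_det_row _ l') big1 // => b _; rewrite !mxE -El.
by rewrite (negPf (neq_lift _ _)) mulr0n mul0r.
Qed.

Lemma axis_eval_deriv j p : (axis_eval j p)^`() = axis_eval j (mderiv (affine_var j) p).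
Proof.
rewrite (@mpoly_chain_rule _ _ _ (axis_eval j) (fun p => (axis_eval j p)^`())).
- rewrite (bigD1 (affine_var j)) //= axis_evalX axis_point_affine eqxx derivX mulr1.
  rewrite big1 ?addr0 // => i; rewrite axis_evalX /axis_point eq_sym.
  case: unliftP => [l ->|_ _]; last by rewrite deriv0 mulr0.
  rewrite affine_var_eq eq_sym => /negPf ->.
  by rewrite derivE mulr0.
- by move=> c; rewrite axis_evalC derivC.
- by move=> a b; rewrite rmorphD derivD.
- by move=> a b; rewrite rmorphM derivM addrC [X in _ + X]mulrC.
Qed.

Lemma axis_eval_row j p : axis_eval j (jacobian_row j p) = d%:R ^+ N.-1 *: (axis_eval j p)^`().
Proof.
have E l : axis_eval j (mderiv (affine_var l) p * cofactor M j l) =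
    axis_eval j (mderiv (affine_var l) p) * (d%:R ^+ N.-1 *+ (l == j))%:P.
  by rewrite rmorphM axis_eval_cofactor.
rewrite /jacobian_row rmorph_sum (eq_bigr _ (fun l _ => E l)) (bigD1 j) //.
rewrite eqxx mulr1n big1.
  by rewrite [LHS]addr0 axis_eval_deriv mulrC mul_polyC.
by move=> l /negPf nlj; rewrite nlj mulr0n polyC0 mulr0.
Qed.

Hypothesis d_gt0 : (0 < d)%N.
Hypothesis natK : forall m, (0 < m <= d)%N -> (m%:R : K) != 0.
Hypothesis homg : forall j, homogeneous_of_degree d.-1 (g j).
Hypothesis crit_zero : forall x : 'I_N.+1 -> K, x ord_max != 0 -> (\det M).@[x] = 0 ->
  exists j, (f j).@[x] = 0.

Lemma dK0 : (d%:R : K) != 0. Proof. by rewrite natK // d_gt0 leqnn. Qed.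

Lemma axis_eval_det j : axis_eval j (\det M) = (d%:R ^+ N.-1 * d%:R) *: 'X^(d.-1).
Proof.
rewrite -(jacobian_row_form j) axis_eval_row axis_eval_form eqxx derivXn.
by rewrite -scaler_nat scalerA.
Qed.

Lemma dhomog_form j : f j \is d.-homog for mdeg.
Proof.
apply: dhomogD.
  have := @dhomogMn _ _ mdeg 1 'X_(affine_var j) d; rewrite mul1n; apply.
  by rewrite dhomogX /= mdeg1.
have := @dhomogM _ _ mdeg 1 'X_ord_max d.-1 (g j); rewrite add1n prednK //; apply.
  by rewrite dhomogX /= mdeg1.
exact: homg.
Qed.

Lemma msize_form j : (msize (f j) <= d.+1)%N.
Proof.
rewrite msizeE; apply/bigmax_leqP_seq => m mf _.
by have /dhomogP /(_ m mf) /= -> := dhomog_form j.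
Qed.

Lemma msize_gt0 (p : {mpoly K[N.+1]}) : p != 0 -> (0 < msize p)%N.
Proof. by rewrite lt0n mmeasure_poly_eq0. Qed.

Lemma msize_exp (p : {mpoly K[N.+1]}) m : p != 0 -> msize (p ^+ m) = ((msize p).-1 * m).+1.
Proof.
move=> p0; elim: m => [|m IHm]; first by rewrite expr0 msize1 muln0.
rewrite exprS msizeM ?expf_neq0 // IHm mulnS addnS /=.
by rewrite -{1}(prednK (msize_gt0 p0)) addSn.
Qed.

Lemma msize2_affine (p : {mpoly K[N.+1]}) (x : 'I_N.+1 -> K) : (msize p <= 2)%N ->
  p.@[x] = p@_0 + \sum_i p@_U_(i) * x i.
Proof.
move=> szp; suff {1}-> : p = (p@_0)%:MP + \sum_i p@_U_(i) *: 'X_i.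
  rewrite mevalD mevalC rmorph_sum; congr (_ + _).
  by apply: eq_bigr => i _; rewrite /= mevalZ mevalXU.
apply/mpolyP => m; rewrite mcoeffD mcoeffC raddf_sum /=.
have coefX i : (p@_U_(i) *: 'X_i)@_m = p@_U_(i) * (U_(i)%MM == m)%:R.
  by rewrite mcoeffZ mcoeffX.
have [/eqP|m_gt0] := posnP (mdeg m).
  rewrite mdeg_eq0 => /eqP ->; rewrite eqxx mulr1 big1 ?addr0 // => i _.
  by rewrite mcoeffZ mcoeffX mnm1_eq0 mulr0.
have -> : (m == 0%MM) = false by rewrite -mdeg_eq0 gtn_eqF.
rewrite mulr0 add0r; have [m_le1|m_gt1] := leqP (mdeg m) 1.
  have /mdeg1P [i /eqP Em] : mdeg m == 1%N by rewrite eqn_leq m_le1.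
  rewrite (bigD1 i) //= big1 ?addr0.
    by rewrite coefX Em eqxx mulr1.
  by move=> l nli; rewrite coefX Em eq_mnm1 (negPf nli) mulr0.
rewrite memN_msupp_eq0 ?msize_mdeg_ge ?(leq_trans szp) //.
rewrite big1 // => i _; rewrite coefX (_ : (_ == m) = false) ?mulr0 //.
by apply: contraTF m_gt1 => /eqP <-; rewrite mdeg1.
Qed.

(** By [crit_zero] and the Nullstellensatz, [p] divides the product of [x_N] and all the [f i]. The
    factor [x_N] is excluded because it restricts to 0 on the axis, and [f i] with [i <> j] because
    it restricts to 1. *)
Lemma prime_divides_form j p : prime_elt p -> divides p (\det M) ->
  (1 < size (axis_eval j p))%N -> divides p (f j).
Proof.
move=> pp dpJ szp; have [_ nv ns] := mpoly_nullst K N.+1; have [p0 p1 pM] := pp.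
have : divides p ('X_ord_max * \prod_i f i).
  apply: ns => // x px; have Jx : (\det M).@[x] = 0.
    by case: dpJ => c ->; rewrite mevalM [p.@[x]]px mulr0.
  rewrite /= mevalM mevalXU; have [->|x0] := eqVneq (x ord_max) 0; first by rewrite mul0r.
  have [i fi] := crit_zero x0 Jx.
  by rewrite rmorph_prod (bigD1 i) //= fi mul0r mulr0.
case/pM=> [[q Eq]|/(prime_divides_prod pp) [i _ dpi]].
- have X0 : ('X_ord_max : {mpoly K[N.+1]}) != 0 by rewrite -msupp_eq0 msuppX.
  have q0 : q != 0 by apply: contraNneq X0 => q0; rewrite Eq q0 mul0r.
  have szX : msize ('X_ord_max : {mpoly K[N.+1]}) = 2%N by rewrite msizeX mdeg1.
  have := szX; rewrite Eq msizeM //.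
  have sp1 : msize p != 1%N.
    apply/negP => /msize_poly1P [c c0 Ep]; apply: p1; exists c^-1%:MP.
    by rewrite Ep -mpolyCM mulVf.
  have := msize_gt0 p0; have := msize_gt0 q0 => q_gt0 p_gt0 E.
  have /msize_poly1P [c c0 Ec] : msize q == 1%N.
    by move: q_gt0 p_gt0 E sp1; move: (msize q) (msize p) => x y; lia.
  have : axis_eval j 'X_ord_max = 0 by rewrite axis_evalX axis_point_max.
  rewrite Eq Ec rmorphM axis_evalC => /eqP.
  rewrite mulf_eq0 polyC_eq0 (negPf c0) => /eqP E0.
  by rewrite E0 size_poly0 in szp.
- have [<- //|nij] := eqVneq i j.
  have := divides_rmorph (axis_eval j) dpi; rewrite axis_eval_form (negPf nij) => -[w Ew].
  have : (axis_eval j p) %| 1 by rewrite Ew dvdp_mull.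
  by rewrite dvdp1 => /eqP E; rewrite E in szp.
Qed.

(** The criterion gives [f j = p ^+ d * q]; since [f j] has degree at most [d], the factor [q] is a
    constant [b] and [p] has degree 1. As [p] vanishes wherever [x_j] and [x_N] do, only these two
    variables occur in it, and [b * a ^+ d = 1] for the coefficient [a] of [x_j]. *)
Lemma form_linear_power j :
  exists c, f j = ('X_(affine_var j) + c *: 'X_ord_max) ^+ d.
Proof.
have [factA nv _] := mpoly_nullst K N.+1.
have [|||||||p [q [Ef szp]]] := @prime_power_criterion K _ (axis_eval j) (jacobian_row j)
    (f j) d (d%:R ^+ N.-1 * d%:R) (d%:R ^+ N.-1) factA d_gt0 _ natK (jacobian_rowM j).
- move=> m /natK m0; exists (m%:R^-1)%:MP.
  have <- : (m%:R : K)%:MP_[N.+1] = m%:R by rewrite rmorph_nat.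
  by rewrite -mpolyCM mulVf.
- by rewrite mulf_neq0 ?expf_neq0 // dK0.
- by rewrite expf_neq0 // dK0.
- by rewrite axis_eval_form eqxx.
- by rewrite jacobian_row_form axis_eval_det.
- exact: axis_eval_row.
- by move=> p pp; rewrite jacobian_row_form; apply: prime_divides_form.
have f0 : f j != 0.
  apply: contraTneq (monicXn K d) => fj0.
  have := axis_eval_form j j; rewrite fj0 rmorph0 eqxx => <-.
  by rewrite monicE lead_coef0 eq_sym oner_neq0.
have [p0 q0] : p != 0 /\ q != 0.
  move: f0; rewrite Ef mulf_eq0 negb_or => /andP [pd0 q0]; split => //.
  by apply: contraNneq pd0 => ->; rewrite expr0n (gtn_eqF d_gt0).
have msp : (1 < msize p)%N.
  rewrite ltnNge; apply/negP => /msize1_polyC Ep.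
  by move: szp; rewrite Ep axis_evalC size_polyC; case: (_ != 0).
have szf := msize_form j; have q_gt0 := msize_gt0 q0.
rewrite Ef msizeM ?expf_neq0 // msize_exp // in szf.
have sp2 : msize p = 2%N by move: q_gt0 msp szf; move: (msize p) (msize q) => x y; nia.
have /msize_poly1P [b b0 Eq] : msize q == 1%N.
  by move: q_gt0 szf; rewrite sp2; move: (msize q) => y; nia.
have aff x := @msize2_affine p x (eq_leq sp2).
have pw x : b * p.@[x] ^+ d = x (affine_var j) ^+ d + x ord_max * (g j).@[x].
  by rewrite -monic_form_meval -/f Ef Eq mevalM mevalC rmorphXn mulrC.
have pz x : x ord_max = 0 -> x (affine_var j) = 0 -> p.@[x] = 0.
  move=> x0 xj; have := pw x; rewrite x0 xj mul0r addr0 expr0n (gtn_eqF d_gt0) => /eqP.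
  by rewrite mulf_eq0 (negPf b0) /= expf_eq0 => /andP [_ /eqP].
pose e i (l : 'I_N.+1) : K := (l == i)%:R.
have pe i : p.@[e i] = p@_0 + p@_U_(i).
  rewrite aff; congr (_ + _); rewrite (bigD1 i) //= big1 ?addr0.
    by rewrite /e eqxx mulr1.
  by move=> l /negPf nli; rewrite /e nli mulr0.
have c00 : p@_0 = 0.
  have := pz (fun=> 0) erefl erefl; rewrite aff big1 ?addr0 // => l _.
  by rewrite mulr0.
have ci i : i != ord_max -> i != affine_var j -> p@_U_(i) = 0.
  move=> im ij; have := pe i; rewrite c00 add0r => <-; apply: pz.
    by rewrite /e eq_sym (negPf im).
  by rewrite /e eq_sym (negPf ij).
set a := p@_U_(affine_var j); set h := p@_U_(ord_max).
have px x : p.@[x] = a * x (affine_var j) + h * x ord_max.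
  rewrite aff c00 add0r (bigD1 ord_max) //= (bigD1 (affine_var j)) ?affine_var_neq_max //=.
  rewrite big1 ?addr0; first by rewrite addrC.
  by move=> i /andP [im ij]; rewrite ci // mul0r.
have ba : b * a ^+ d = 1.
  have := pw (e (affine_var j)); rewrite px /e eqxx [ord_max == _]eq_sym affine_var_neq_max.
  by rewrite mulr1 mulr0 addr0 mul0r addr0 expr1n.
have a0 : a != 0.
  by apply: contra_eqN ba => /eqP ->; rewrite expr0n (gtn_eqF d_gt0) mulr0 eq_sym oner_eq0.
exists (h / a); apply/eqP; rewrite -subr_eq0; apply: contraT => /nv [x].
rewrite /= mevalB monic_form_meval -pw px rmorphXn /= mevalD mevalZ !mevalXU.
have -> : a * x (affine_var j) + h * x ord_max = a * (x (affine_var j) + h / a * x ord_max).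
  by rewrite mulrDr mulrA mulrCA divff // mulr1.
by rewrite exprMn mulrA ba mul1r subrr eqxx.
Qed.

(** Expanding [(x_j + c x_N)^d] shows that [g j] takes the value [d * c] at the given point, so that
    [c = 0]. *)
Lemma form_power j : (g j).@[fun i => (i == affine_var j)%:R] = 0 -> g j = 0.
Proof.
move=> gj; have [c] := form_linear_power j.
rewrite /f /monic_form => /(canRL (addKr _)); rewrite addrC subrXX.
rewrite [X in (X - _) * _]addrC addrK -scalerAl scalerAr => /mulfI E.
have {}E : g j = c *: \sum_(i < d) ('X_(affine_var j) + c *: 'X_ord_max) ^+ (d.-1 - i) *
    'X_(affine_var j) ^+ i by apply: E; rewrite -msupp_eq0 msuppX.
suff c0 : c = 0 by rewrite E c0 scale0r.
move: gj; rewrite E mevalZ rmorph_sum (eq_bigr (fun=> 1)) => [|i _].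
  rewrite sumr_const card_ord => /eqP; rewrite mulf_eq0 (negPf dK0) orbF => /eqP //.
rewrite /= mevalM !rmorphXn /= mevalD mevalZ !mevalXU eqxx [ord_max == _]eq_sym.
by rewrite affine_var_neq_max mulr0 addr0 !expr1n mulr1.
Qed.

End Rigidity.

(** * Valuation rings and residue fields *)

(** Integer coefficients serve all characteristics at once: it is the image of [p] in [k] that has
    to be nonzero. *)
Definition algebraic_over_prime (k : fieldType) (a : k) :=
  exists2 p : {poly int}, map_poly (intr : int -> k) p != 0
                        & root (map_poly (intr : int -> k) p) a.

Lemma exprVM (F : fieldType) (x : F) i m : x != 0 -> (i <= m)%N ->
  x^-1 ^+ i * x ^+ m = x ^+ (m - i).
Proof.
by move=> x0 le_im; rewrite -{1}(subnK le_im) exprD mulrCA exprVn mulVf ?mulr1 // expf_neq0.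
Qed.

Section MaximalSubring.
Variables (k : fieldType) (t : k).

(** So [t] is a non-unit of [S], whereas the integers that are nonzero in [k] are units. *)
Definition subring_with (S : k -> Prop) :=
  [/\ S 1 /\ S t, forall x y, S x -> S y -> S (x - y),
      forall x y, S x -> S y -> S (x * y),
      forall n, (n%:R : k) != 0 -> S n%:R^-1 & ~ S t^-1].

Lemma subring_with_closed S : subring_with S ->
  [/\ S 0, forall x y, S x -> S y -> S (x + y), forall x n, S x -> S (x ^+ n)
    & forall (I : Type) (r : seq I) (F : I -> k), (forall i, S (F i)) ->
        S (\sum_(i <- r) F i)].
Proof.
move=> [[S1 _] SB SM _ _]; have S0 : S 0 by rewrite -(subrr 1); apply: SB.
have SD x y : S x -> S y -> S (x + y).
  by move=> Sx Sy; rewrite -[y]opprK; apply: (SB) => //; rewrite -sub0r; apply: SB.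
split => //.
  by move=> x n Sx; elim: n => [|n IHn]; rewrite ?expr0 ?exprS //; apply: SM.
by move=> I r F SF; elim/big_rec: _ => // i x _ Sx; apply: SD.
Qed.

Lemma maximal_subring S0 : subring_with S0 -> exists S, subring_with S /\
  forall S', subring_with S' -> (forall x, S x -> S' x) -> forall x, S' x -> S x.
Proof.
move=> HS0; pose T := {S : k -> Prop | subring_with S}.
pose le (A B : T) := boolp.asbool (forall x, sval A x -> sval B x).
have [|||C Ctot|[S HS] max] := @classical_sets.Zorn T le.
- by move=> A; apply/boolp.asboolP.
- by move=> A B C /boolp.asboolP AB /boolp.asboolP BC; apply/boolp.asboolP => x /AB /BC.
- move=> [A HA] [B HB] /boolp.asboolP /= AB /boolp.asboolP /= BA.
  have EAB : A = B by apply/boolp.funext => x; apply/boolp.propext; split; [exact: AB | exact: BA].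
  by move: HA HB; rewrite EAB => HA HB; congr exist; apply: boolp.Prop_irrelevance.
(* The empty chain is bounded by [S0], a nonempty one by its union: two elements of the union lie in
   a common member. *)
- case: (boolp.EM (exists A, C A)) => [[A0 CA0]|nC]; last first.
    exists (exist _ S0 HS0) => B CB; case: nC; by exists B.
  pose U x := exists2 A : T, C A & sval A x.
  have join A B : C A -> C B -> exists D : T, [/\ C D, forall x, sval A x -> sval D x
      & forall x, sval B x -> sval D x].
    move=> CA CB; have [/boolp.asboolP le_AB|/boolp.asboolP le_AB] := Ctot _ _ CA CB.
      by exists B; split.
    by exists A; split.
  have HU : subring_with U.
    split.
    - by split; exists A0 => //; case: (svalP A0) => -[].
    - move=> x y [A CA Ax] [B CB By]; have [D [CD AD BD]] := join A B CA CB.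
      exists D => //; have [_ DB _ _ _] := svalP D.
      by apply: DB; [apply: AD | apply: BD].
    - move=> x y [A CA Ax] [B CB By]; have [D [CD AD BD]] := join A B CA CB.
      exists D => //; have [_ _ DM _ _] := svalP D.
      by apply: DM; [apply: AD | apply: BD].
    - move=> n n0; exists A0 => //; have [_ _ _ Q _] := svalP A0; exact: Q.
    - by move=> [A CA]; have [_ _ _ _ Q] := svalP A; exact: Q.
  by exists (exist _ U HU) => A CA; apply/boolp.asboolP => x Ax; exists A.
exists S; split => // S' HS' le_SS' x.
have := max (exist _ S' HS'); rewrite /le => H.
suff [<- //] : exist _ S' HS' = exist _ S HS :> T.
by apply: H; apply/boolp.asboolP.
Qed.

Definition adjoin (S : k -> Prop) (x y : k) :=
  exists2 p : {poly k}, (forall i, S p`_i) & y = p.[x].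

(** By maximality the larger ring [S[x]] must violate [subring_with], and only the exclusion of
    [t^-1] can fail. *)
Lemma adjoin_inv S x : subring_with S ->
  (forall S', subring_with S' -> (forall x, S x -> S' x) -> forall x, S' x -> S x) ->
  ~ S x -> adjoin S x t^-1.
Proof.
move=> HS max nSx; apply: boolp.contrapT => nadj; apply: nSx.
have [S0 SD SX Ssum] := subring_with_closed HS.
have [[S1 St] SB SM SQ nSt] := HS.
have incl y : S y -> adjoin S x y.
  move=> Sy; exists y%:P; last by rewrite hornerC.
  by move=> i; rewrite coefC; case: eqP.
apply: (max (adjoin S x)) => //; last first.
  by exists 'X; rewrite ?hornerX // => i; rewrite coefX; case: (_ == _).
split.
- by split; apply: incl.
- move=> _ _ [p Sp ->] [q Sq ->]; exists (p - q); rewrite ?hornerE // => i.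
  by rewrite coefB; apply: SB.
- move=> _ _ [p Sp ->] [q Sq ->]; exists (p * q); rewrite ?hornerM // => i.
  by rewrite coefM; apply: (Ssum) => j; apply: SM.
- by move=> n /SQ /incl.
- exact: nadj.
Qed.

Section Valuation.
Variable S : k -> Prop.
Hypothesis HS : subring_with S.
Hypothesis max : forall S', subring_with S' -> (forall x, S x -> S' x) -> forall x, S' x -> S x.

Lemma t_neq0 : t != 0.
Proof.
have [[_ St] _ _ _ nSt] := HS.
by apply: contra_notN nSt => /eqP t0; move: St; rewrite t0 invr0.
Qed.

(** Otherwise [t^-1] is a polynomial in [w^-1] over [S]. Multiplying by a power
    [w ^+ n = 1 - t * c'] clears the denominators and puts [t^-1] in [S]. *)
Lemma one_sub_unit c : S c -> S (1 - t * c)^-1.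
Proof.
move=> Sc; have [S0 SD SX Ssum] := subring_with_closed HS.
have [[S1 St] SB SM SQ nSt] := HS; have t0 := t_neq0.
set w := 1 - t * c; have Sw : S w by apply: SB => //; apply: SM.
have w0 : w != 0.
  apply: contra_notN nSt; rewrite subr_eq0 => /eqP E.
  by rewrite -[t^-1]mulr1 E mulKf.
apply: boolp.contrapT => /(adjoin_inv HS max) [p Sp E]; apply: nSt.
have wE n : exists2 c', S c' & w ^+ n = 1 - t * c'.
  elim: n => [|n [c' Sc' IHn]]; first by exists 0; rewrite // mulr0 subr0.
  exists (c + w * c'); first by apply: SD => //; apply: SM.
  by rewrite exprS IHn /w; ring.
have [c' Sc' Ec'] := wE (size p).
have Sb : S (p.[w^-1] * w ^+ size p).
  rewrite horner_coef mulr_suml; apply: Ssum => i; rewrite -mulrA; apply: (SM) => //.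
  by rewrite exprVn mulrC -expfB //; apply: SX.
have -> : t^-1 = p.[w^-1] * w ^+ size p + c'.
  by rewrite -E Ec' mulrBr mulr1 mulrA mulVf // mul1r subrK.
exact: SD.
Qed.

Let relation n x := exists p : {poly k}, [/\ forall i, S p`_i, (size p <= n.+1)%N & 1 = t * p.[x]].

(** The relation for [x^-1], multiplied by [x ^+ n.+1] and divided by the unit [1 - t * q_0],
    expresses [x ^+ n.+1] through lower powers with coefficients in [t S]. Substituting this removes
    the top term of the relation for [x]. *)
Lemma relation_reduce n m x : x != 0 -> (m <= n.+1)%N ->
  relation n.+1 x -> relation m x^-1 -> relation n x.
Proof.
move=> x0 le_mn [p [Sp szp Ep]] [q [Sq szq Eq]].
have [S0 SD SX Ssum] := subring_with_closed HS; have [[S1 St] SB SM SQ nSt] := HS.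
set v := (1 - t * q`_0)^-1; have Sv : S v by apply: one_sub_unit.
have u0 : 1 - t * q`_0 != 0.
  apply: contra_notN nSt; rewrite subr_eq0 => /eqP E.
  by rewrite -[t^-1]mulr1 E mulKf // t_neq0.
pose r := \poly_(i < n.+1) (p`_i + t * p`_n.+1 * (q`_(n.+1 - i) * v)).
exists r; split.
- by move=> i; rewrite coef_poly; case: ifP => // _; apply: SD => //; do 2!apply: (SM) => //.
- exact: size_poly.
have Eq' : x ^+ n.+1 = t * \sum_(i < n.+1) (q`_(n.+1 - i) * v) * x ^+ i.
  have szq' : (size q <= n.+2)%N by apply: leq_trans szq _.
  have E : x ^+ n.+1 = t * \sum_(i < n.+2) q`_i * x ^+ (n.+1 - i).
    rewrite -[LHS]mul1r Eq (horner_coef_wide _ szq') -mulrA mulr_suml; congr (_ * _).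
    apply: eq_bigr => i _; rewrite -mulrA; congr (_ * _).
    have le_i : (i <= n.+1)%N by rewrite -ltnS.
    exact: exprVM.
  rewrite big_ord_recl /= subn0 in E.
  have {}E : (1 - t * q`_0) * x ^+ n.+1 = t * \sum_(i < n.+1) q`_i.+1 * x ^+ (n - i).
    by rewrite mulrBl mul1r {1}E mulrDr mulrA [X in X - _]addrC addrK.
  apply: (mulfI u0); rewrite E (reindex_inj rev_ord_inj) /= [RHS]mulrCA; congr (_ * _).
  rewrite mulr_sumr; apply: eq_bigr => i _; have le_in : (i <= n)%N by rewrite -ltnS.
  rewrite subSS -(subSn le_in) subKn //.
  have uv : (1 - t * q`_0) * v = 1 by apply: mulfV.
  transitivity ((1 - t * q`_0) * v * (q`_(n.+1 - i) * x ^+ i)); first by rewrite uv mul1r.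
  by rewrite -!mulrA [v * (_ * _)]mulrCA.
rewrite {1}Ep (horner_coef_wide _ szp) big_ord_recr /= Eq'.
rewrite horner_poly; congr (_ * _).
rewrite mulrA mulr_sumr -big_split; apply: eq_bigr => i _ /=.
by ring.
Qed.

(** Chevalley's descent: the relation of larger degree is shortened by means of the other one, until
    a relation of degree 0 makes [t] invertible in [S]. *)
Lemma no_relation n m x : x != 0 -> relation n x -> relation m x^-1 -> False.
Proof.
have rel0 y : relation 0 y -> False.
  have [_ _ _ _ nSt] := HS; move=> [p [Sp /size1_polyC Ep E]]; apply: nSt.
  by rewrite -[t^-1]mulr1 E Ep hornerC mulKf // t_neq0.
have [l] := ubnP (n + m)%N; elim: l => // l IHl in n m x *; rewrite ltnS => le_nm x0 Rn Rm.
case: n => [|n] in Rn le_nm *; first exact: rel0 Rn.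
case: m => [|m] in Rm le_nm *; first exact: rel0 Rm.
have [le_mn|lt_nm] := leqP m n.
  by apply: (IHl n m.+1 x) => //; apply: (@relation_reduce n m.+1).
have Rx : relation n.+1 x^-1^-1 by rewrite invrK.
apply: (IHl n.+1 m x) => //; first by rewrite -addnS.
by apply: (@relation_reduce m n.+1); rewrite ?invr_eq0 // ltnW.
Qed.

Lemma maximal_valuation x : S x \/ S x^-1.
Proof.
have [->|x0] := eqVneq x 0; first by left; case: (subring_with_closed HS).
case: (boolp.EM (S x)) => [|nSx]; [by left|right].
apply: boolp.contrapT => nSx'.
have rel y : ~ S y -> exists n, relation n y.
  move=> /(adjoin_inv HS max) [p Sp E]; exists (size p), p; split => //.
  by rewrite -E divff // t_neq0.
have [[n Rn] [m Rm]] := (rel _ nSx, rel _ nSx').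
exact: (@no_relation n m x).
Qed.

End Valuation.
End MaximalSubring.

Record valuation_ring (k : fieldType) := ValuationRing {
  vr_mem :> {pred k};
  vr_closed : subring_closed vr_mem;
  vr_total : forall x, (x \in vr_mem) || (x^-1 \in vr_mem)
}.

HB.instance Definition _ (k : fieldType) (V : valuation_ring k) :=
  GRing.isSubringClosed.Build k (vr_mem V) (vr_closed V).

Record vr_elt (k : fieldType) (V : valuation_ring k) := VrElt {
  vr_val : k;
  vr_valP : vr_val \in vr_mem V
}.

HB.instance Definition _ (k : fieldType) (V : valuation_ring k) :=
  [isSub for @vr_val k V].
HB.instance Definition _ (k : fieldType) (V : valuation_ring k) :=
  [Choice of vr_elt V by <:].
HB.instance Definition _ (k : fieldType) (V : valuation_ring k) :=
  [SubChoice_isSubComNzRing of vr_elt V by <:].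

Section ResidueField.
Local Open Scope quotient_scope.
Variables (k : fieldType) (V : valuation_ring k).

Lemma vr_val_mem (x : vr_elt V) : val x \in V.
Proof. exact: valP. Qed.

(* The non-units; note that 0^-1 = 0 belongs to V. *)
Definition vr_max : {pred vr_elt V} := fun x => (val x == 0) || ((val x)^-1 \notin V).

Lemma vr_maxPn x : reflect (val x != 0 /\ (val x)^-1 \in V) (x \notin vr_max).
Proof. by rewrite unfold_in negb_or negbK; apply: andP. Qed.

Lemma vr_maxM a u : u \in vr_max -> a * u \in vr_max.
Proof.
apply: contraLR => /vr_maxPn []; rewrite rmorphM mulf_eq0 negb_or => /andP [a0 u0] H.
apply/vr_maxPn; split => //.
have -> : (val u)^-1 = val a * (val a * val u)^-1 by rewrite invfM mulrA divff // mul1r.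
by apply: rpredM => //; apply: vr_val_mem.
Qed.

(** One of [v / u] and [u / v] lies in [V]; in the first case [u + v = (1 + v / u) u]. *)
Lemma vr_maxD u v : u \in vr_max -> v \in vr_max -> u + v \in vr_max.
Proof.
have [->|u0] := eqVneq u 0; first by rewrite add0r.
have [->|v0] := eqVneq v 0; first by rewrite addr0.
have val0 (x : vr_elt V) : x != 0 -> val x != 0.
  by apply: contraNneq => x0; apply/eqP/val_inj; rewrite x0 rmorph0.
wlog H : u v u0 v0 / val v / val u \in V => [wlog_H|].
  case/orP: (vr_total V (val v / val u)) => H; first exact: wlog_H.
  by move=> um vm; rewrite addrC; apply: wlog_H => //; rewrite -invf_div.
move=> um _; pose a : vr_elt V := VrElt H.
have -> : u + v = (1 + a) * u; last exact: vr_maxM.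
apply: val_inj; rewrite rmorphD rmorphM rmorphD rmorph1 /=.
by rewrite mulrDl mul1r mulfVK // val0.
Qed.

Lemma vr_max_idealr : idealr_closed vr_max.
Proof.
split; first by rewrite unfold_in rmorph0 eqxx.
  by apply/vr_maxPn; rewrite rmorph1 oner_neq0 invr1; split=> //; exact: rpred1.
by move=> a u v um vm; apply: vr_maxD => //; apply: vr_maxM.
Qed.

HB.instance Definition _ := isIdealr.Build (vr_elt V) vr_max vr_max_idealr.

Definition residue_field : Type := {ideal_quot vr_max}.
HB.instance Definition _ := GRing.ComNzRing.on residue_field.

Definition residue_map (x : vr_elt V) : residue_field := \pi_{ideal_quot vr_max} x.

Lemma residue_mapB : {morph residue_map : x y / x - y}.
Proof. by move=> x y; rewrite /residue_map !piE. Qed.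

Lemma residue_mapM : {morph residue_map : x y / x * y}.
Proof. by move=> x y; rewrite /residue_map !piE. Qed.

Lemma residue_map1 : residue_map 1 = 1.
Proof. by rewrite /residue_map !piE. Qed.

HB.instance Definition _ :=
  GRing.isZmodMorphism.Build (vr_elt V) residue_field residue_map residue_mapB.
HB.instance Definition _ :=
  GRing.isMonoidMorphism.Build (vr_elt V) residue_field residue_map
    (conj residue_map1 residue_mapM).

Lemma residue_map_eq0 x : (residue_map x == 0) = (x \in vr_max).
Proof.
rewrite -(rmorph0 residue_map) /residue_map.
have := @Quotient.idealrBE (vr_elt V) vr_max x 0; rewrite subr0 => ->.
by [].
Qed.

Lemma residue_map_surj y : exists x, residue_map x = y.
Proof. by exists (repr (y : {ideal_quot vr_max})); rewrite /residue_map reprK. Qed.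

(** The default 0 of [insubd] on non-units also yields the convention that 0 is its own inverse in
    the residue field. *)
Definition vr_inv (x : vr_elt V) : vr_elt V := insubd 0 (val x)^-1.

Lemma vr_invK x : x \notin vr_max -> vr_inv x * x = 1.
Proof.
move=> /vr_maxPn [x0 xV]; apply: val_inj.
have E : val (vr_inv x) = (val x)^-1 := insubdK 0 xV.
by rewrite rmorphM rmorph1 /= E mulVf.
Qed.

Definition residue_inv (y : residue_field) : residue_field :=
  residue_map (vr_inv (repr (y : {ideal_quot vr_max}))).

Lemma residue_mulVf y : y != 0 -> residue_inv y * y = 1.
Proof.
have E : y = residue_map (repr (y : {ideal_quot vr_max})) by rewrite /residue_map reprK.
rewrite {1 3}E residue_map_eq0 => ym.
by rewrite /residue_inv -rmorphM vr_invK ?rmorph1.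
Qed.

Lemma residue_inv0 : residue_inv 0 = 0.
Proof.
rewrite /residue_inv; set x := repr _.
have : residue_map x == 0 by rewrite /residue_map reprK.
rewrite residue_map_eq0 /vr_inv unfold_in => /orP [/eqP ->|xV].
  by rewrite invr0 (_ : insubd 0 0 = 0) ?rmorph0 //; apply: val_inj; rewrite insubdK ?rmorph0 //= rpred0.
by rewrite (_ : insubd 0 _ = 0) ?rmorph0 // /insubd insubN.
Qed.

HB.instance Definition _ :=
  GRing.ComNzRing_isField.Build residue_field residue_mulVf residue_inv0.

End ResidueField.

Section ClosedResidueField.
Variables (k : closedFieldType) (V : valuation_ring k).

Lemma residue_closed : GRing.closed_field_axiom (residue_field V).
Proof.
move=> n P n_gt0.
have [Q HQ] := boolp.choice (fun i => residue_map_surj (P i)).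
have [r Er] := solve_monicpoly (fun i => val (Q i)) n_gt0.
have rV : r \in V.
  apply: contraT => nrV; have := vr_total V r; rewrite (negPf nrV) /= => riV.
  have r0 : r != 0 by apply: contraNneq nrV => ->; apply: rpred0.
  suff : r \in V by rewrite (negPf nrV).
  (* With [r^-1] in [V], dividing the monic equation by [r ^+ n.-1] writes [r] as a polynomial in
     [r^-1] over [V]. *)
  have -> : r = \sum_(i < n) val (Q i) * r^-1 ^+ (n.-1 - i).
    apply: (mulIf (expf_neq0 n.-1 r0)); rewrite -exprS prednK // Er mulr_suml.
    apply: eq_bigr => i _; rewrite -mulrA; congr (_ * _).
    have le_i : (i <= n.-1)%N by rewrite -ltnS prednK.
    by rewrite -{2}(subnK le_i) exprD mulrA exprVn mulVf ?mul1r // expf_neq0.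
  by apply: rpred_sum => i _; apply: rpredM; [apply: vr_val_mem | apply: rpredX].
exists (residue_map (VrElt rV)).
have E : (VrElt rV) ^+ n = \sum_(i < n) Q i * (VrElt rV) ^+ i.
  apply: val_inj; rewrite rmorphXn rmorph_sum /= Er.
  by apply: eq_bigr => i _; rewrite -[vr_val (_ ^+ _)]/(val (_ ^+ _)) rmorphXn.
rewrite -rmorphXn E rmorph_sum; apply: eq_bigr => i _.
by rewrite rmorphM rmorphXn /= HQ.
Qed.

HB.instance Definition _ := Field_isAlgClosed.Build (residue_field V) residue_closed.

End ClosedResidueField.

(** The subring is taken maximal with [t = a^-1], so that excluding [t^-1] excludes [a]. The
    conclusion keeps only what is used of a place: the image of [iota] consists of the elements of
    size at most 1, and the kernel of [pi] of those of size less than 1. *)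
Theorem place_exists (k : closedFieldType) (a : k) : ~ algebraic_over_prime a ->
  exists (O : comNzRingType) (F : closedFieldType)
         (iota : {rmorphism O -> k}) (pi : {rmorphism O -> F}),
  [/\ injective iota, forall y, exists o, pi o = y,
      forall x, (exists o, x = iota o) \/ (exists2 o, pi o = 0 & x^-1 = iota o),
      forall o, pi o != 0 -> exists o', o * o' = 1
    & (forall o, a <> iota o) /\ forall n, (n%:R : k) != 0 -> (n%:R : F) != 0].
Proof.
move=> nalg; pose ev (p : {poly int}) x := (map_poly (intr : int -> k) p).[x].
pose S0 x := exists n p, (n%:R : k) != 0 /\ n%:R * x = ev p a^-1.
have a0 : a != 0.
  apply/eqP => a0; apply: nalg; exists 'X; first by rewrite map_polyX polyX_eq0.
  by rewrite map_polyX /root hornerX a0.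
have HS0 : subring_with a^-1 S0.
  split.
  - split.
      by exists 1%N, 1%:P; rewrite oner_neq0 /ev map_polyC hornerC mulr1.
    by exists 1%N, 'X; rewrite oner_neq0 /ev map_polyX hornerX mul1r.
  - move=> x y [n [p [n0 Ep]]] [m [q [m0 Eq]]].
    exists (n * m)%N, ((m%:R : int) *: p - (n%:R : int) *: q).
    split; first by rewrite natrM mulf_neq0.
    rewrite /ev rmorphB /= !map_polyZ hornerD hornerN !hornerZ -!/(ev _ _) -Ep -Eq.
    by rewrite !rmorph_nat natrM; ring.
  - move=> x y [n [p [n0 Ep]]] [m [q [m0 Eq]]].
    exists (n * m)%N, (p * q); split; first by rewrite natrM mulf_neq0.
    have -> : ev (p * q) a^-1 = ev p a^-1 * ev q a^-1 by rewrite /ev rmorphM hornerM.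
    by rewrite -Ep -Eq natrM; ring.
  - by move=> n n0; exists n, 1%:P; rewrite n0 /ev map_polyC hornerC divff.
  - rewrite invrK => -[n [p [n0 Ep]]]; apply: nalg; set m := size p in Ep *.
    (* Multiplying [n a = p(a^-1)] by [a^m] makes [a] a root of this polynomial, whose leading
       coefficient [n] is nonzero in [k]. *)
    exists ((n%:R : int) *: 'X^(m.+1) - \sum_(i < m) p`_i *: 'X^(m - i)).
      apply/eqP => /(congr1 (fun r : {poly k} => r`_m.+1)); rewrite coef_map coef0 /=.
      rewrite coefB coefZ coefXn eqxx mulr1 coef_sum big1 ?subr0 => [/eqP|i _].
        by rewrite rmorph_nat (negPf n0).
      by rewrite coefZ coefXn gtn_eqF ?mulr0 // ltnS leq_subr.
    rewrite /root rmorphB /= map_polyZ map_polyXn rmorph_sum hornerD hornerN hornerZ hornerXn.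
    rewrite rmorph_nat exprS mulrA Ep /ev (horner_coef_wide _ (size_poly _ _)) -/m.
    rewrite horner_sum mulr_suml subr_eq0; apply/eqP; apply: eq_bigr => i _.
    rewrite /= map_polyZ map_polyXn hornerZ hornerXn coef_poly ltn_ord -mulrA; congr (_ * _).
    by rewrite exprVM // ltnW.
have [S [HS max]] := maximal_subring HS0.
have valS := maximal_valuation HS max.
have [[S1 St] SB SM SQ nSt] := HS.
pose mem : {pred k} := fun x => boolp.asbool (S x).
have memP x : reflect (S x) (x \in mem) by apply: boolp.asboolP.
have mem_closed : subring_closed mem.
  by split=> [|x y /memP Sx /memP Sy|x y /memP Sx /memP Sy]; apply/memP; auto.
have mem_total x : (x \in mem) || (x^-1 \in mem).
  by apply/orP; case: (valS x) => /memP; [left|right].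
pose V := ValuationRing mem_closed mem_total.
exists (vr_elt V), (residue_field V), (\val : {rmorphism vr_elt V -> k}), (@residue_map k V).
have maxE (o : vr_elt V) : (residue_map o == 0) = (o \in @vr_max k V) by apply: residue_map_eq0.
split.
- exact: val_inj.
- exact: residue_map_surj.
- move=> x; have [Sx|nSx] := boolP (x \in mem); first by left; exists (VrElt (Sx : x \in vr_mem V)).
  have x'V : x^-1 \in vr_mem V by have := mem_total x; rewrite (negPf nSx).
  right; exists (VrElt x'V) => //; apply/eqP; rewrite maxE unfold_in /= invrK.
  by rewrite (nSx : x \notin V) orbT.
- move=> o; rewrite maxE => om; exists (vr_inv o).
  by rewrite mulrC vr_invK.
- split.
    move=> o E; apply: nSt; rewrite invrK E; apply/memP; exact: vr_valP.
  move=> n n0; rewrite -(rmorph_nat (@residue_map k V)) maxE; apply/vr_maxPn.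
  rewrite rmorph_nat; split => //; apply/memP; exact: SQ.
Qed.

(** * Escaping critical points *)

Lemma meval_map_mpoly (R S : comNzRingType) (f : {rmorphism R -> S}) (n : nat)
    (x : 'I_n -> R) (p : {mpoly R[n]}) :
  (map_mpoly f p).@[f \o x] = f p.@[x].
Proof.
apply: (mpoly_rmorph_eq (f := meval (f \o x) \o map_mpoly f) (g := f \o meval x)) => [c|i] /=.
  by rewrite map_mpolyC !mevalC.
by rewrite map_mpolyX !mevalXU.
Qed.

Lemma meval_homogeneous (R : comNzRingType) (n e : nat) (p : {mpoly R[n]}) (c : R)
    (x : 'I_n -> R) : p \is e.-homog for mdeg ->
  p.@[fun i => c * x i] = c ^+ e * p.@[x].
Proof.
move=> /dhomogP hom; rewrite (mpolyE p) !rmorph_sum mulr_sumr /=; apply: eq_big_seq => m mp.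
rewrite !mevalZ !mevalX mulrCA -(hom m mp) /= mdegE -prodrXr -big_split /=.
by congr (_ * _); apply: eq_bigr => i _; rewrite exprMn.
Qed.

Lemma map_monic_form (R S : comNzRingType) (N d : nat) (f : {rmorphism R -> S})
    (G : 'I_N -> {mpoly R[N.+1]}) j :
  map_mpoly f (monic_form d G j) = monic_form d (fun j => map_mpoly f (G j)) j.
Proof. by rewrite /monic_form rmorphD rmorphM rmorphXn /= !map_mpolyX. Qed.

Lemma affine_jacobian_map (R S : comNzRingType) (N d : nat) (f : {rmorphism R -> S})
    (G : 'I_N -> {mpoly R[N.+1]}) :
  \det (affine_jacobian (monic_form d (fun j => map_mpoly f (G j)))) =
  map_mpoly f (\det (affine_jacobian (monic_form d G))).
Proof.
rewrite -det_map_mx; congr (\det _); apply/matrixP => i j; rewrite !mxE /=.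
by rewrite -mderiv_map_mpoly map_monic_form.
Qed.

Lemma affine_jacobian_infinity (R : comNzRingType) (N d : nat)
    (G : 'I_N -> {mpoly R[N.+1]}) (x : 'I_N.+1 -> R) : x ord_max = 0 ->
  (\det (affine_jacobian (monic_form d G))).@[x] =
  \prod_i (x (affine_var i) ^+ d.-1 *+ d).
Proof.
move=> x0; rewrite -det_map_mx.
have -> : map_mx (meval x) (affine_jacobian (monic_form d G)) =
    diag_mx (\row_i (x (affine_var i) ^+ d.-1 *+ d)).
  apply/matrixP => i j; rewrite mxE affine_jacobian_monicE !mxE /= mevalD mevalM !mevalMn.
  by rewrite rmorphXn /= !mevalXU x0 mul0r addr0.
by rewrite det_diag; apply: eq_bigr => i _; rewrite mxE.
Qed.

Section Substitution.
Variables (R : comNzRingType) (n : nat) (h : 'I_n -> {mpoly R[n]}).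

Definition msubst : {rmorphism {mpoly R[n]} -> {mpoly R[n]}} := mmap (@mpolyC n R) h.

Lemma msubstX i : msubst 'X_i = h i.
Proof. by rewrite /msubst /= mmapX mmap1U. Qed.

Lemma msubstC c : msubst c%:MP = c%:MP.
Proof. by rewrite /msubst /= mmapC. Qed.

Lemma msubstZ c p : msubst (c *: p) = c *: msubst p.
Proof. by rewrite -!mul_mpolyC rmorphM msubstC. Qed.

Lemma msubst_meval p x : (msubst p).@[x] = p.@[fun i => (h i).@[x]].
Proof.
apply: (mpoly_rmorph_eq (f := meval x \o msubst) (g := meval _)) => [c|i] /=.
  by rewrite msubstC !mevalC.
by rewrite msubstX mevalXU.
Qed.

Lemma msubst_mderiv p j : (forall i, mderiv j (h i) = (i == j)%:R) ->
  mderiv j (msubst p) = msubst (mderiv j p).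
Proof.
move=> hj; rewrite (@mpoly_chain_rule _ _ _ msubst (fun p => mderiv j (msubst p))).
- rewrite (bigD1 j) // big1 => [|i /negPf nij].
    by rewrite [LHS]addr0 msubstX hj eqxx mulr1.
  by rewrite msubstX hj nij mulr0.
- by move=> c; rewrite msubstC mderivC.
- by move=> a b; rewrite rmorphD mderivD.
- by move=> a b; rewrite rmorphM mderivM addrC [X in _ + X]mulrC.
Qed.

Lemma msubst_homog p e : (forall i, h i \is 1.-homog for mdeg) ->
  p \is e.-homog for mdeg -> msubst p \is e.-homog for mdeg.
Proof.
move=> hh /dhomogP hp; rewrite /msubst /= /mmap big_seq; apply: rpred_sum => m mp.
rewrite mul_mpolyC; apply: dhomogZ; rewrite -(hp m mp) /= mdegE /mmap1.
elim: (index_enum _) => [|i s IHs]; first by rewrite !big_nil dhomog1.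
rewrite !big_cons; apply: dhomogM => //.
by have := dhomogMn (m i) (hh i); rewrite mul1n.
Qed.

End Substitution.

Lemma dhomog_expand (R : comNzRingType) (n e b : nat) (p : {mpoly R[n]}) : (e < b)%N ->
  p \is e.-homog for mdeg ->
  p = \sum_(m : 'X_{1..n < b} | mdeg m == e) p@_m *: 'X_[m].
Proof.
move=> lt_eb hp; have szp : (msize p <= b)%N.
  rewrite msizeE; apply/bigmax_leqP_seq => m mp _.
  by move/dhomogP: hp => /(_ m mp) /= ->.
rewrite {1}(mpolywE szp) (bigID (fun m : 'X_{1..n < b} => mdeg m == e)) /=.
rewrite [X in _ + X]big1 ?addr0 // => m nm.
by rewrite (dhomog_nemf_coeff hp) ?scale0r.
Qed.

Lemma mcoeff_bsum (R : comNzRingType) (n b : nat) (P : pred 'X_{1..n < b})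
    (c : 'X_{1..n < b} -> R) (m : 'X_{1..n < b}) : P m ->
  (\sum_(m' : 'X_{1..n < b} | P m') c m' *: 'X_[m'])@_m = c m.
Proof.
move=> Pm; rewrite raddf_sum /= (bigD1 m) //= mcoeffZ mcoeffX eqxx mulr1.
rewrite big1 ?addr0 // => m' /andP [_ /negPf nm].
by rewrite mcoeffZ mcoeffX -bmeqP nm mulr0.
Qed.

(** Otherwise the characteristic would be a prime divisor of [m], hence at most [d]. *)
Lemma natr_neq0_pchar (k : fieldType) (d : nat) :
  (forall p : nat, p \in [pchar k] -> (d < p)%N) ->
  forall m, (0 < m <= d)%N -> (m%:R : k) != 0.
Proof.
move=> hchar m /andP [m0 le_md]; apply/negP => m0k.
have [p pk] := natf0_pchar m0 m0k.
move: m0k; rewrite -(dvdn_pcharf pk) => /(dvdn_leq m0) le_pm.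
by have := hchar p pk; rewrite ltnNge (leq_trans le_pm).
Qed.

Lemma closed_field_nth_root (k : closedFieldType) (a : k) (n : nat) : (0 < n)%N ->
  exists b, b ^+ n = a.
Proof.
move=> n_gt0; have /closed_rootP [b] : size ('X^n - a%:P : {poly k}) != 1%N.
  by rewrite size_XnsubC //; case: n n_gt0.
by rewrite /root !hornerE subr_eq0 => /eqP E; exists b.
Qed.

Section Place.
Variables (k F : closedFieldType) (O : comNzRingType).
Variables (iota : {rmorphism O -> k}) (pi : {rmorphism O -> F}).
Hypothesis iota_inj : injective iota.
Hypothesis pi_surj : forall y, exists o, pi o = y.
Hypothesis valuative : forall x, (exists o, x = iota o) \/ (exists2 o, pi o = 0 & x^-1 = iota o).
Hypothesis pi_unit : forall o, pi o != 0 -> exists o', o * o' = 1.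

Lemma iota_eq0 o : (iota o == 0) = (o == 0).
Proof. by rewrite -(inj_eq iota_inj) rmorph0. Qed.

Lemma inv_iota_unit o : pi o != 0 -> exists o', (iota o)^-1 = iota o'.
Proof.
move=> /pi_unit [o' E]; exists o'; apply/esym/divr1_eq/eqP.
rewrite invrK -rmorphM mulrC E rmorph1 //.
Qed.

(* A root whose inverse is integral contributes a factor 1 - b X to Q = Q(0) prod (1 - b X),
   so if no root reduces to 0 then Q(0) divides all the coefficients of Q. *)
Lemma lift_zero_root (q : {poly O}) : map_poly pi q != 0 -> pi q`_0 = 0 ->
  exists2 s, pi s = 0 & q.[s] = 0.
Proof.
move=> q0 q00; apply: boolp.contrapT => noroot.
have [rs Ers] := closed_field_poly_normal (map_poly iota q).
set Q := map_poly iota q in Ers.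
have inv r : r \in rs -> r != 0 /\ exists b, r^-1 = iota b.
  move=> rrs; have Qr : Q.[r] = 0.
    by rewrite Ers hornerZ (big_rem r rrs) hornerM /= hornerXsubC subrr mul0r mulr0.
  have nm o : r = iota o -> pi o != 0.
    move=> Er; apply/eqP => po; apply: noroot; exists o => //.
    by apply/eqP; rewrite -iota_eq0 -horner_map -Er Qr.
  split; first by apply/eqP => r0; have := nm 0; rewrite rmorph0 => /(_ r0); rewrite rmorph0 eqxx.
  by case: (valuative r) => [[o Er]|[o _ Er]]; [rewrite Er; apply/inv_iota_unit/nm | exists o].
have [B [c [EB B0]]] : exists (B : {poly O}) (c : k),
    \prod_(z <- rs) ('X - z%:P) = c *: map_poly iota B /\ B`_0 = 1.
  elim: (rs) inv => [|r s IHs] inv.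
    by exists 1, 1; rewrite big_nil rmorph1 scale1r coef1.
  have [r0 [b Eb]] := inv r (mem_head _ _).
  have [|B [c [E B0]]] := IHs; first by move=> x xs; apply: inv; rewrite inE xs orbT.
  exists ((1 - b *: 'X) * B), (- r * c); split; last first.
    by rewrite coefM big_ord1 subnn B0 mulr1 coefB coef1 coefZ coefX mulr0 subr0.
  rewrite big_cons E rmorphM rmorphB rmorph1 /= map_polyZ map_polyX -Eb -scalerA -scalerAr.
  rewrite [RHS]scalerA [- r * c]mulrC -[RHS]scalerA; congr (_ *: _); rewrite scalerAl; congr (_ * _).
  by rewrite scalerBr scalerA mulNr divff // scaleN1r opprK scaleNr addrC alg_polyC.
have Eq : q = q`_0 *: B.
  apply: (map_inj_poly iota_inj); first exact: rmorph0.
  rewrite map_polyZ -/Q Ers EB scalerA; congr (_ *: _).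
  have := congr1 (fun Q : {poly k} => Q`_0) Ers.
  by rewrite /= EB scalerA coefZ !coef_map /= B0 rmorph1 mulr1 => ->.
by move: q0; rewrite Eq map_polyZ q00 scale0r eqxx.
Qed.

(** Restrict [p] to the line joining lifts of [w] (at [s = 0]) and [v] (at [s = 1]). The restriction
    has nonzero reduction and reduces to 0 at 0, so it has a root [s] with [pi s = 0]. *)
Lemma lift_zero (n : nat) (p : {mpoly O[n]}) (w v : 'I_n -> F) :
  (map_mpoly pi p).@[w] = 0 -> (map_mpoly pi p).@[v] != 0 ->
  exists2 x, forall i, pi (x i) = w i & p.@[x] = 0.
Proof.
have [w0 Ew] := boolp.choice (fun i => pi_surj (w i)).
have [v0 Ev] := boolp.choice (fun i => pi_surj (v i)).
have -> : w = pi \o w0 by apply/boolp.funext => i /=.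
have -> : v = pi \o v0 by apply/boolp.funext => i /=.
rewrite !meval_map_mpoly => pw pv.
pose line : {rmorphism {mpoly O[n]} -> {poly O}} :=
  mmap (@polyC O) (fun i => (w0 i)%:P + (v0 i - w0 i) *: 'X).
have lineE s : (line p).[s] = p.@[fun i => w0 i + (v0 i - w0 i) * s].
  apply: (mpoly_rmorph_eq (f := horner_eval s \o line) (g := meval _)) => [c|i] /=.
    by rewrite /horner_eval /line /= mmapC hornerC mevalC.
  by rewrite /horner_eval /line /= mmapX mmap1U mevalXU hornerD hornerC hornerZ hornerX.
have [||s ps Es] := @lift_zero_root (line p).
- apply: contraNneq pv => E; have := congr1 (fun q : {poly F} => q.[pi 1]) E.
  rewrite /= horner_map lineE horner0 => <-; apply/eqP; congr (pi _); apply: meval_eq => i.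
  by rewrite mulr1 addrC subrK.
- by rewrite -horner_coef0 lineE -pw; congr (pi _); apply: meval_eq => i; rewrite mulr0 addr0.
exists (fun i => w0 i + (v0 i - w0 i) * s); last by rewrite -lineE.
by move=> i; rewrite rmorphD rmorphM ps mulr0 addr0 /=.
Qed.

Lemma valuation_total (a b : k) : (exists o, a = b * iota o) \/ (exists o, b = a * iota o).
Proof.
have [->|b0] := eqVneq b 0; first by right; exists 0; rewrite rmorph0 mulr0.
have [->|a0] := eqVneq a 0; first by left; exists 0; rewrite rmorph0 mulr0.
case: (valuative (a / b)) => [[o E]|[o _ E]]; [left|right]; exists o; rewrite -E.
  by rewrite mulrCA divff // mulr1.
by rewrite invf_div mulrCA divff // mulr1.
Qed.

Lemma dominant (I : finType) (i : I) (c : I -> k) :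
  exists i0, forall j, exists o, c j = c i0 * iota o.
Proof.
suff [i0 H] : exists i0, forall j, j \in i :: enum I -> exists o, c j = c i0 * iota o.
  by exists i0 => j; apply: H; rewrite inE mem_enum orbT.
have self l : exists o, c l = c l * iota o by exists 1; rewrite rmorph1 mulr1.
elim: (enum I) => [|l s [i0 IHs]].
  by exists i => j; rewrite inE => /eqP ->.
have sub j : j \in i :: l :: s -> j = l \/ j \in i :: s.
  by rewrite !inE => /or3P [->|/eqP ->|->]; rewrite ?orbT; auto.
case: (valuation_total (c l) (c i0)) => [[o E]|[o E]].
  by exists i0 => j /sub [->|/IHs //]; exists o.
exists l => j /sub [->|/IHs [o' E']]; first exact: self.
by exists (o * o'); rewrite E' E rmorphM mulrA.
Qed.

(** * Dynamics near the hyperplane at infinity *)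

Section Dynamics.
Variables (N d : nat) (G : 'I_N -> {mpoly O[N.+1]}) (g : 'I_N -> {mpoly k[N.+1]}).
Variables (rho : k) (e0 : O).
Hypothesis d_gt1 : (1 < d)%N.
Hypothesis natF : forall m, (0 < m <= d)%N -> (m%:R : F) != 0.
Hypothesis rho0 : rho != 0.
Hypothesis rhoV : rho^-1 = iota e0.
Hypothesis pie0 : pi e0 = 0.

Definition rescale_point (x : 'I_N.+1 -> k) (i : 'I_N.+1) : k :=
  if i == ord_max then rho * x i else x i.

Definition rescale := msubst (fun i : 'I_N.+1 => if i == ord_max then rho *: 'X_i else 'X_i).

Hypothesis homg : forall j, homogeneous_of_degree d.-1 (g j).
Hypothesis g_rescale : forall j, g j = rho *: rescale (map_mpoly iota (G j)).

Lemma rescale_meval p x : (rescale p).@[x] = p.@[rescale_point x].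
Proof.
rewrite msubst_meval; apply: meval_eq => i; rewrite /rescale_point.
by case: ifP; rewrite ?mevalZ mevalXU.
Qed.

Lemma rescale_mderiv p j :
  mderiv (affine_var j) (rescale p) = rescale (mderiv (affine_var j) p).
Proof.
apply: msubst_mderiv => i; rewrite [in RHS]eq_sym.
case: (i =P ord_max) => [->|_]; last exact: mderivXU.
by rewrite mderivZ mderivXU affine_var_neq_max scaler0.
Qed.

Let f := monic_form d g.
Let ft := monic_form d G.

(** The outer factor [rho] in [g_rescale] joins [x_N]: the form [f j] is the integral form [ft j] in
    the coordinate [rho x_N]. *)
Lemma form_rescale j : f j = rescale (map_mpoly iota (ft j)).
Proof.
rewrite /f /ft /monic_form g_rescale !rmorphD !rmorphM !rmorphXn /= !map_mpolyX !msubstX.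
by rewrite affine_var_neq_max eqxx -scalerAr -scalerAl.
Qed.

Lemma det_rescale :
  \det (affine_jacobian f) = rescale (map_mpoly iota (\det (affine_jacobian ft))).
Proof.
rewrite -!det_map_mx; congr (\det _); apply/matrixP => i j; rewrite !mxE.
by rewrite form_rescale rescale_mderiv mderiv_map_mpoly.
Qed.

Lemma integral_form (x : 'I_N.+1 -> k) (z : 'I_N.+1 -> O) :
  (forall i, rescale_point x i = iota (z i)) ->
  forall j, (f j).@[x] = iota (ft j).@[z].
Proof.
move=> E j; rewrite form_rescale rescale_meval -meval_map_mpoly; apply: meval_eq => i.
exact: E.
Qed.

Lemma integral_det (x : 'I_N.+1 -> k) (z : 'I_N.+1 -> O) :
  (forall i, rescale_point x i = iota (z i)) ->
  (\det (affine_jacobian f)).@[x] = iota (\det (affine_jacobian ft)).@[z].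
Proof.
move=> E; rewrite det_rescale rescale_meval -meval_map_mpoly; apply: meval_eq => i.
exact: E.
Qed.

Definition cone_point (T : Type) (u : 'I_N -> T) (h : T) (i : 'I_N.+1) : T :=
  if unlift ord_max i is Some j then u j else h.

Lemma cone_point_max T (u : 'I_N -> T) h : cone_point u h ord_max = h.
Proof. by rewrite /cone_point unlift_none. Qed.

Lemma cone_point_affine T (u : 'I_N -> T) h j : cone_point u h (affine_var j) = u j.
Proof. by rewrite /cone_point liftK. Qed.

Lemma rescale_cone_point (x : 'I_N.+1 -> k) (u : 'I_N -> O) (h : O) :
  (forall j, x (affine_var j) = iota (u j)) -> rho * x ord_max = iota h ->
  forall i, rescale_point x i = iota (cone_point u h i).
Proof.
move=> Eu Eh i; rewrite /rescale_point; have [->|ne] := eqVneq i ord_max.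
  by rewrite cone_point_max.
have /unlift_some [j Ej _] : ord_max != i by rewrite eq_sym.
by rewrite Ej cone_point_affine Eu.
Qed.

Lemma reduce_form (u : 'I_N -> O) (h : O) j : pi h = 0 ->
  pi (ft j).@[cone_point u h] = pi (u j) ^+ d.
Proof.
move=> ph; rewrite monic_form_meval rmorphD rmorphM rmorphXn /=.
by rewrite cone_point_max ph mul0r addr0 cone_point_affine.
Qed.

Let Phi := endo_eval (monic_poly_map d g).

Lemma Phi_affine x j : Phi x (affine_var j) = (f j).@[x].
Proof. by rewrite /Phi /endo_eval /monic_poly_map liftK. Qed.

Lemma Phi_max x : Phi x ord_max = x ord_max ^+ d.
Proof. by rewrite /Phi /endo_eval /monic_poly_map unlift_none rmorphXn /= mevalXU. Qed.

Lemma iter_Phi_max x n : iter n Phi x ord_max = x ord_max ^+ (d ^ n).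
Proof.
elim: n => [|n IHn]; first by rewrite expr1.
by rewrite iterS Phi_max IHn -exprM -expnSr.
Qed.

(** The homogeneous coordinates are scaled so that the affine ones have size 1. If moreover
    [rho x_N] reduces to 0, all the ratios [x_j / x_N] have the same size [1 / |x_N|], larger than
    [|rho|]. *)
Definition affine_units (x : 'I_N.+1 -> k) :=
  exists2 u, forall j, x (affine_var j) = iota (u j) & forall j, pi (u j) != 0.

(** Where [rho x_N] reduces to 0 the form reduces to the power map, which preserves units. *)
Lemma units_forward x eta : rho * x ord_max = iota eta -> pi eta = 0 ->
  affine_units x -> affine_units (Phi x).
Proof.
move=> Eh peta [u Eu pu]; have E := rescale_cone_point Eu Eh.
exists (fun j => (ft j).@[cone_point u eta]).
  by move=> j; rewrite Phi_affine (integral_form E).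
by move=> j; rewrite reduce_form // expf_neq0.
Qed.

(* If some coordinate is not integral, the largest one, say M, dominates: its image is
   M^d times a unit, which is not integral. *)
Lemma units_backward x eta : rho * x ord_max = iota eta -> pi eta = 0 ->
  affine_units (Phi x) -> affine_units x.
Proof.
move=> Eh peta [u Eu pu].
have [z Ez] : exists z, forall j, x (affine_var j) = iota (z j).
  case: (boolp.EM (exists j : 'I_N, True)) => [[j1 _]|nj]; last first.
    by exists (fun=> 0) => j; case: nj; exists j.
  have [j0 /boolp.choice [z Ez]] := dominant j1 (fun j => x (affine_var j)).
  set M := x (affine_var j0) in Ez.
  case: (valuative M) => [[o Eo]|[b pb Eb]].
    by exists (fun j => o * z j) => j; rewrite rmorphM -Eo.
  exfalso.
  have [M0|M0] := eqVneq M 0.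
    have := Eu j0; rewrite Phi_affine (integral_form (rescale_cone_point (u := fun=> 0) _ Eh)).
      move=> /iota_inj E; have := pu j0; rewrite -E reduce_form // rmorph0.
      by rewrite expr0n (gtn_eqF (ltnW d_gt1)) eqxx.
    by move=> j; rewrite Ez M0 mul0r rmorph0.
  pose y i := M^-1 * x i.
  have Ey i : rescale_point y i = iota (cone_point z (b * eta) i).
    apply: rescale_cone_point => [j|]; rewrite /y; first by rewrite Ez mulKf.
    by rewrite mulrCA Eh Eb rmorphM.
  have zj0 : z j0 = 1.
    by apply/iota_inj/(mulfI M0); rewrite -Ez rmorph1 mulr1.
  have pv : pi (ft j0).@[cone_point z (b * eta)] = 1.
    by rewrite reduce_form ?rmorphM ?peta ?mulr0 // zj0 rmorph1 expr1n.
  have Ex : (f j0).@[x] = M ^+ d * (f j0).@[y].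
    rewrite -meval_homogeneous; last exact: dhomog_form (ltnW d_gt1) homg j0.
    by apply: meval_eq => i; rewrite /y mulVKf.
  have : b ^+ d * u j0 = (ft j0).@[cone_point z (b * eta)].
    apply: iota_inj; rewrite rmorphM rmorphXn -Eb -Eu Phi_affine Ex (integral_form Ey).
    by rewrite mulrA -exprMn mulVf // expr1n mul1r.
  move=> /(congr1 pi); rewrite pv rmorphM rmorphXn pb expr0n (gtn_eqF (ltnW d_gt1)) mul0r.
  by move/eqP; rewrite eq_sym oner_eq0.
exists z => // j; have := Eu j.
rewrite Phi_affine (integral_form (rescale_cone_point Ez Eh)) => /iota_inj E.
have := pu j; rewrite -E reduce_form // expf_eq0 negb_and => /orP [|//].
by rewrite (ltnW d_gt1).
Qed.

(** Here [|h| < 1 / |rho| < 1], so taking powers of [h] only decreases its size. *)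
Lemma small_power (h : k) (o : O) m : rho * h = iota o -> pi o = 0 -> (0 < m)%N ->
  exists2 o', rho * h ^+ m = iota o' & pi o' = 0.
Proof.
move=> E po m_gt0; have Eh : h = iota (e0 * o) by rewrite rmorphM -rhoV -E mulKf.
exists (o * (e0 * o) ^+ m.-1).
  by rewrite rmorphM rmorphXn -Eh -E -mulrA -exprS prednK.
by rewrite rmorphM po mul0r.
Qed.

Theorem critical_reduction : PCF (monic_poly_map d g) ->
  forall w : 'I_N.+1 -> F, w ord_max != 0 ->
  (\det (affine_jacobian (monic_form d (fun j => map_mpoly pi (G j))))).@[w] = 0 ->
  exists j, (monic_form d (fun j => map_mpoly pi (G j)) j).@[w] = 0.
Proof.
move=> [Mb HM] w w0; rewrite affine_jacobian_map => Jw; apply: boolp.contrapT => nzero.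
(* The reduced Jacobian is not identically zero: its value at the point [(1, ..., 1, 0)] at infinity
   is [d^N]. *)
have Jv : (map_mpoly pi (\det (affine_jacobian ft))).@[cone_point (fun=> 1) 0] != 0.
  rewrite -affine_jacobian_map affine_jacobian_infinity ?cone_point_max //.
  apply/prodf_neq0 => i _; rewrite cone_point_affine expr1n.
  by rewrite natF // (ltnW d_gt1) leqnn.
have [W pW JW] := lift_zero Jw Jv.
(* With [eps] as last coordinate, rescaling [X0] gives back [W], so [X0] is critical. As [w ord_max]
   is nonzero, [|eps| = 1 / |rho|]. *)
pose eps := rho^-1 * iota (W ord_max).
pose X0 : 'I_N.+1 -> k := cone_point (fun j => iota (W (affine_var j))) eps.
have EX0 i : rescale_point X0 i = iota (W i).
  rewrite /rescale_point /X0; have [->|ne] := eqVneq i ord_max.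
    by rewrite cone_point_max mulVKf.
  have /unlift_some [j Ej _] : ord_max != i by rewrite eq_sym.
  by rewrite Ej cone_point_affine.
have pWm : pi (W ord_max) != 0 by rewrite pW.
have eps0 : eps != 0.
  rewrite mulf_neq0 ?invr_eq0 // iota_eq0; apply: contraNneq pWm => ->.
  by rewrite rmorph0.
have critX0 : crit_cone (monic_poly_map d g) X0.
  by rewrite /crit_cone jacobian_monic mevalM (integral_det EX0) JW rmorph0 mulr0.
have max0 : X0 ord_max = eps by rewrite /X0 cone_point_max.
have Ereps : rho * eps = iota (W ord_max) by rewrite /eps mulVKf.
have smallP n : (1 < n)%N -> exists2 o, rho * eps ^+ n = iota o & pi o = 0.
  move=> n_gt1; exists (W ord_max * (e0 * W ord_max) ^+ n.-1); last first.
    rewrite rmorphM rmorphXn rmorphM pie0 mul0r expr0n.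
    by rewrite (_ : (n.-1 == 0)%N = false) ?mulr0 //; case: n n_gt1 => [|[]].
  rewrite rmorphM rmorphXn [iota (e0 * _)]rmorphM -rhoV -/eps -Ereps -mulrA -exprS.
  by rewrite prednK // ltnW.
have units n : affine_units (iter n.+1 Phi X0).
  elim: n => [|n IHn].
    exists (fun j => (ft j).@[W]) => j; first by rewrite /= Phi_affine (integral_form EX0).
    apply/eqP => pj; apply: nzero; exists j; rewrite -pj -meval_map_mpoly map_monic_form.
    by apply: meval_eq => i /=; rewrite pW.
  have [|o Eo po] := smallP (d ^ n.+1)%N; first by rewrite -{1}(expn0 d) ltn_exp2l.
  rewrite iterS; apply: (units_forward (x := iter n.+1 Phi X0) _ po IHn).
  by rewrite iter_Phi_max max0.
have [i0 [lt_i0 _]] := HM 0; have Mb_gt0 : (0 < Mb)%N := leq_ltn_trans (leq0n _) lt_i0.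
(* Taking the bound [Mb] itself as the time forces [i < Mb]: the point reached from [X0] is also
   reached from a critical [x] in strictly fewer steps. *)
have [i [lt_iM Hi]] := HM Mb.
have /Hi [x [critx Ex]] : crit_image (monic_poly_map d g) Mb (iter Mb Phi X0).
  by exists X0.
have unitsx : affine_units (iter i Phi x).
  by rewrite -[iter i Phi x]Ex -(prednK Mb_gt0); apply: units.
have hE : x ord_max ^+ (d ^ i) = eps ^+ (d ^ Mb).
  by rewrite -iter_Phi_max -max0 -iter_Phi_max Ex.
set h := x ord_max in hE.
have h0 : h != 0.
  have : h ^+ (d ^ i) != 0 by rewrite hE expf_neq0.
  by apply: contraNneq => ->; rewrite expr0n expn_eq0 (gtn_eqF (ltnW d_gt1)).
(* From [hE], the size of [h] is that of [eps] raised to the power [d ^ (Mb - i)]. Since [i < Mb]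
   this is less than [|eps| = 1 / |rho|]. *)
have [o Eo po] : exists2 o, rho * h = iota o & pi o = 0.
  have [o' Eo' po'] : exists2 o', (rho * h) ^+ (d ^ i) = iota o' & pi o' = 0.
    exists (W ord_max ^+ (d ^ i) * (e0 * W ord_max) ^+ (d ^ Mb - d ^ i)).
      rewrite [LHS]exprMn hE rmorphM !rmorphXn [iota (e0 * _)]rmorphM -rhoV -/eps -Ereps.
      rewrite [(rho * eps) ^+ _]exprMn.
      by rewrite -mulrA -exprD subnKC // leq_exp2l // ltnW.
    rewrite rmorphM !rmorphXn rmorphM pie0 mul0r expr0n subn_eq0 leqNgt ltn_exp2l //.
    by rewrite lt_iM mulr0.
  have di_gt0 : (0 < d ^ i)%N by rewrite expn_gt0 (ltnW d_gt1).
  case: (valuative (rho * h)) => [[o Eo]|[b pb Eb]].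
    exists o => //; have : pi o ^+ (d ^ i) = 0.
      by rewrite -rmorphXn -po'; congr (pi _); apply: iota_inj; rewrite rmorphXn -Eo.
    by move/eqP; rewrite expf_eq0 => /andP [_ /eqP].
  have : b ^+ (d ^ i) * o' = 1.
    apply: iota_inj; rewrite rmorphM rmorphXn -Eb -Eo' -exprMn mulVf ?mulf_neq0 //.
    by rewrite expr1n rmorph1.
  by move=> /(congr1 pi) /eqP; rewrite rmorphM po' mulr0 rmorph1 eq_sym oner_eq0.
have {}unitsx : affine_units x.
  elim: i unitsx {lt_iM Hi Ex hE} => [//|i IHi] ui; apply: IHi.
  have [|o' Eo' po'] := @small_power h o (d ^ i)%N Eo po.
    by rewrite expn_gt0 (ltnW d_gt1).
  by apply: (units_backward (x := iter i Phi x) _ po' ui); rewrite iter_Phi_max.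
have [u Eu pu] := unitsx.
have : crit_cone (monic_poly_map d g) x by [].
rewrite /crit_cone jacobian_monic mevalM mevalMn rmorphXn /= mevalXU -/h.
rewrite (integral_det (rescale_cone_point Eu Eo)) => /eqP.
rewrite mulf_eq0 iota_eq0 => /orP [|/eqP J0].
  rewrite -mulr_natr mulf_eq0 expf_eq0 (negPf h0) andbF /= => /eqP dk0.
  have : (d%:R : F) != 0 by rewrite natF // (ltnW d_gt1) leqnn.
  rewrite -(rmorph_nat pi) (_ : d%:R = 0) ?rmorph0 ?eqxx //.
  by apply: iota_inj; rewrite rmorph_nat rmorph0.
(* At such an [x] the determinant reduces to the product of the [d u_j^(d-1)], which is nonzero: [x]
   is not critical. *)
have := congr1 pi J0; rewrite rmorph0 -meval_map_mpoly -affine_jacobian_map.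
rewrite affine_jacobian_infinity /= ?cone_point_max // => /eqP.
apply/negP; apply/prodf_neq0 => j _; rewrite /= cone_point_affine -mulr_natr.
by rewrite mulf_neq0 ?expf_neq0 // natF // (ltnW d_gt1) leqnn.
Qed.

End Dynamics.
End Place.

(** * Countability *)

Lemma rescale_monomial (k : closedFieldType) (N : nat) (rho : k) (m : 'X_{1..N.+1}) :
  rescale N rho 'X_[m] = rho ^+ m ord_max *: 'X_[m].
Proof.
rewrite /rescale /msubst /= mmapX /mmap1 (bigD1 ord_max) //= eqxx.
rewrite (mpolyXE_id _ m) [in RHS](bigD1 ord_max) //= exprZn -scalerAl; congr (_ *: (_ * _)).
by apply: eq_bigr => i /negPf ->.
Qed.

Lemma zero_algebraic (k : fieldType) : algebraic_over_prime (0 : k).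
Proof.
exists 'X; first by rewrite map_polyX polyX_eq0.
by rewrite map_polyX /root hornerX.
Qed.

(** At this point a form of degree [d - 1] takes as value its coefficient of [x_j^(d-1)]. *)
Definition unit_point (R : comNzRingType) (N : nat) (j : 'I_N) (i : 'I_N.+1) : R :=
  (i == affine_var j)%:R.

(** Rescaling multiplies a coefficient of [g] whose monomial has exponent [e] in [x_N] by a power of
    [rho] with exponent [e + 1], so sizes are compared through [(e + 1)]-th roots. With [rho] the
    largest root, all coefficients of [G] are integral and one of them is 1, whereas rigidity makes
    the reduction of that component vanish. *)
Theorem normalized_PCF_algebraic (k : closedFieldType) (N d : nat) (g : 'I_N -> {mpoly k[N.+1]}) :
  (1 < d)%N -> (forall p : nat, p \in [pchar k] -> (d < p)%N) ->
  (forall j, homogeneous_of_degree d.-1 (g j)) ->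
  (forall j, (g j).@[@unit_point k N j] = 0) ->
  PCF (monic_poly_map d g) ->
  forall j m, algebraic_over_prime (g j)@_m.
Proof.
move=> d_gt1 hchar homg gj0 pcf j1 m1; apply: boolp.contrapT => nalg.
have d_gt0 := ltnW d_gt1; have lt_d : (d.-1 < d)%N by rewrite prednK.
have a0 : (g j1)@_m1 != 0 by apply/eqP => a0; apply: nalg; rewrite a0; apply: zero_algebraic.
have deg j m : (g j)@_m != 0 -> mdeg m == d.-1.
  by apply: contraNT => nm; rewrite (dhomog_nemf_coeff (homg j) nm).
have m1d : (mdeg m1 < d)%N by rewrite (eqP (deg _ _ a0)).
have [O [F [iota [pi [iota_inj pi_surj valuative pi_unit [naO natP]]]]]] := place_exists nalg.
pose I := ('I_N * 'X_{1..N.+1 < d})%type.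
have [b Eb] := boolp.choice (fun i : I =>
  closed_field_nth_root (g i.1)@_(i.2 : 'X_{1..N.+1}) (ltn0Sn ((i.2 : 'X_{1..N.+1}) ord_max))).
pose i1 : I := (j1, BMultinom m1d).
have [i0 /boolp.choice [o Eo]] := dominant valuative i1 b.
set rho := b i0 in Eo.
have rho0 : rho != 0.
  by apply: contraNneq a0 => r0; rewrite -[m1]/(i1.2 : 'X_{1..N.+1}) -[j1]/(i1.1) -Eb Eo r0 mul0r expr0n.
pose G j := \sum_(m : 'X_{1..N.+1 < d} | mdeg m == d.-1)
  o (j, m) ^+ (m ord_max).+1 *: ('X_[m] : {mpoly O[N.+1]}).
have g_rescale j : g j = rho *: rescale N rho (map_mpoly iota (G j)).
  have -> : rho *: rescale N rho (map_mpoly iota (G j)) =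
      \sum_(m : 'X_{1..N.+1 < d} | mdeg m == d.-1)
        rho *: rescale N rho (map_mpoly iota (o (j, m) ^+ (m ord_max).+1 *: 'X_[m])).
    by rewrite -scaler_sumr -rmorph_sum -rmorph_sum.
  rewrite [LHS](dhomog_expand lt_d (homg j)); apply: eq_bigr => m _.
  rewrite map_mpolyZ map_mpolyX [rescale _ _ _]msubstZ rescale_monomial !scalerA.
  congr (_ *: _).
  by rewrite rmorphXn mulrAC -exprS -exprMn -Eo (Eb (j, m)).
(* If [rho] were integral, so would be the coefficient at [i1], a power of [rho * o i1]; but the
   place was chosen to exclude it. *)
have [e0 rhoV pie0] : exists2 e0, rho^-1 = iota e0 & pi e0 = 0.
  case: (valuative rho) => [[r Er]|[e pe Ee]]; last by exists e.
  exfalso; apply: (naO ((r * o i1) ^+ (m1 ord_max).+1)).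
  by rewrite rmorphXn rmorphM -Er -Eo; exact/esym/(Eb i1).
have natF m : (0 < m <= d)%N -> (m%:R : F) != 0.
  by move=> /(natr_neq0_pchar hchar) /natP.
have homG j : homogeneous_of_degree d.-1 (map_mpoly pi (G j)).
  suff : map_mpoly pi (G j) \is d.-1.-homog for mdeg by [].
  rewrite rmorph_sum; apply: rpred_sum => m /eqP Em.
  by rewrite /= map_mpolyZ map_mpolyX; apply: dhomogZ; rewrite dhomogX /= Em.
have crit := critical_reduction iota_inj pi_surj valuative pi_unit d_gt1 natF rho0 rhoV pie0
  homg g_rescale pcf.
have Gj0 j : (map_mpoly pi (G j)).@[fun i => (i == affine_var j)%:R] = 0.
  have Gz : (G j).@[@unit_point O N j] = 0.
    apply: iota_inj; rewrite rmorph0 -meval_map_mpoly; apply: (mulfI rho0).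
    rewrite mulr0 -(gj0 j) [in RHS]g_rescale mevalZ rescale_meval; congr (_ * _).
    apply: meval_eq => i /=; rewrite /rescale_point /unit_point rmorph_nat.
    by case: (i =P ord_max) => [->|//]; rewrite eq_sym affine_var_neq_max mulr0.
  rewrite -[RHS](rmorph0 pi) -Gz -meval_map_mpoly; apply: meval_eq => i /=.
  by rewrite /unit_point rmorph_nat.
have m0d : mdeg i0.2 == d.-1.
  by apply: (deg i0.1); rewrite -Eb expf_neq0.
have := form_power d_gt0 natF homG crit (Gj0 i0.1).
move=> /(congr1 (mcoeff (i0.2 : 'X_{1..N.+1}))).
rewrite mcoeff0 mcoeff_map_mpoly (@mcoeff_bsum _ _ _ (fun m => mdeg m == d.-1)) //.
have oi0 : o i0 = 1 by apply/iota_inj/(mulfI rho0); rewrite -Eo rmorph1 mulr1.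
rewrite -surjective_pairing oi0 expr1n => /eqP.
move=> /eqP E; have := oner_neq0 F; rewrite -(rmorph1 pi); apply/negP/negPn/eqP.
exact: E.
Qed.

(** * Normalisation by a translation *)

Section Translation.
Variables (k : closedFieldType) (N d : nat) (g : 'I_N -> {mpoly k[N.+1]}) (c : 'I_N -> k).
Hypothesis d_gt1 : (1 < d)%N.
Hypothesis homg : forall j, homogeneous_of_degree d.-1 (g j).

Definition shift_coef (i : 'I_N.+1) : k := if unlift ord_max i is Some j then c j else 0.

Definition shift := msubst (fun i : 'I_N.+1 => 'X_i + shift_coef i *: 'X_ord_max).

Definition shift_point (x : 'I_N.+1 -> k) (i : 'I_N.+1) : k := x i + shift_coef i * x ord_max.

Lemma shift_coef_max : shift_coef ord_max = 0.
Proof. by rewrite /shift_coef unlift_none. Qed.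

Lemma shift_coef_affine j : shift_coef (affine_var j) = c j.
Proof. by rewrite /shift_coef liftK. Qed.

Lemma shift_meval p x : (shift p).@[x] = p.@[shift_point x].
Proof.
by rewrite msubst_meval; apply: meval_eq => i; rewrite mevalD mevalZ !mevalXU.
Qed.

Lemma shift_mderiv p j : mderiv (affine_var j) (shift p) = shift (mderiv (affine_var j) p).
Proof.
apply: msubst_mderiv => i; rewrite mderivD mderivZ !mderivXU affine_var_neq_max scaler0.
by rewrite addr0 eq_sym.
Qed.

(** The data of the map conjugated by [x_j -> x_j + c_j x_N]. The sum is the quotient of
    [(x_j + c_j x_N)^d - x_j^d] by [c_j x_N] in telescoped form, and the last term translates the
    image back. *)
Definition shifted (j : 'I_N) : {mpoly k[N.+1]} :=
  shift (g j) + c j *: (\sum_(i < d) shift 'X_(affine_var j) ^+ (d.-1 - i) * 'X_(affine_var j) ^+ i)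
  - c j *: 'X_ord_max ^+ d.-1.

Lemma monic_form_shifted j :
  monic_form d shifted j = shift (monic_form d g j) - c j *: 'X_ord_max ^+ d.
Proof.
set H : {mpoly k[N.+1]} := 'X_ord_max; set x : {mpoly k[N.+1]} := 'X_(affine_var j).
have Ey : shift x = x + c j *: H by rewrite msubstX shift_coef_affine.
have EH : shift H = H by rewrite msubstX shift_coef_max scale0r addr0.
have -> : shift (monic_form d g j) = shift x ^+ d + H * shift (g j).
  by rewrite rmorphD rmorphM rmorphXn EH.
have -> : H ^+ d = H * H ^+ d.-1 by rewrite -exprS prednK // ltnW.
have := subrXX (shift x) x d => /(canRL (subrK _)) ->.
have -> : shift x - x = c j *: H by rewrite Ey addrC addKr.
rewrite /monic_form /shifted -/H -/x -!mul_mpolyC.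
by move: (shift (g j)) (\sum_(i < d) _) => t S; ring.
Qed.

Lemma shifted_homog j : homogeneous_of_degree d.-1 (shifted j).
Proof.
have lin i : ('X_i + shift_coef i *: 'X_ord_max : {mpoly k[N.+1]}) \is 1.-homog for mdeg.
  by apply: dhomogD; last apply: dhomogZ; rewrite dhomogX /= mdeg1.
have pw (p : {mpoly k[N.+1]}) e : p \is 1.-homog for mdeg -> p ^+ e \is e.-homog for mdeg.
  by move=> /(dhomogMn e); rewrite mul1n.
suff : shifted j \is d.-1.-homog for mdeg by [].
apply: rpredB; last by apply: dhomogZ; apply: pw; rewrite dhomogX /= mdeg1.
apply: rpredD; first by apply: msubst_homog => //; exact: homg.
apply: dhomogZ; apply: rpred_sum => i _.
have le_i : (i <= d.-1)%N by rewrite -ltnS prednK // ltnW.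
have : shift 'X_(affine_var j) ^+ (d.-1 - i) * 'X_(affine_var j) ^+ i
    \is (d.-1 - i + i).-homog for mdeg.
  by apply: dhomogM; apply: pw; rewrite ?msubstX // dhomogX /= mdeg1.
by rewrite subnK.
Qed.

Lemma shift_unit_point j i : shift_point (@unit_point k N j) i = unit_point k j i.
Proof. by rewrite /shift_point /unit_point [ord_max == _]eq_sym affine_var_neq_max mulr0 addr0. Qed.

(** Each of the [d] terms of the sum equals 1 at this point, so a suitable [c j] cancels the
    coefficient of [x_j^(d-1)] when [d] is invertible. *)
Lemma shifted_unit_point j :
  (shifted j).@[@unit_point k N j] = (g j).@[@unit_point k N j] + c j * d%:R.
Proof.
rewrite /shifted mevalB mevalD !mevalZ shift_meval (meval_eq _ (shift_unit_point j)).
rewrite [X in _ - X](_ : _ = 0) ?subr0; last first.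
  rewrite rmorphXn /= mevalXU /unit_point eq_sym affine_var_neq_max expr0n.
  by rewrite (_ : (d.-1 == 0)%N = false) ?mulr0 //; case: d d_gt1 => [|[]].
congr (_ + _ * _); rewrite rmorph_sum (eq_bigr (fun=> 1)) ?sumr_const ?card_ord //= => i _.
rewrite mevalM !rmorphXn /= shift_meval (meval_eq _ (shift_unit_point j)) !mevalXU.
by rewrite /unit_point eqxx !expr1n mulr1.
Qed.

Definition shift_mx : 'M[k]_N.+1 :=
  1%:M + (\col_i shift_coef i) *m delta_mx 0 ord_max.

(** Since the last shift coefficient is 0, [u *m e] has square zero and [1 - u *m e] is the
    inverse. *)
Lemma shift_mx_unit : shift_mx \in unitmx.
Proof.
set u : 'cV[k]_N.+1 := \col_i shift_coef i; set e : 'rV[k]_N.+1 := delta_mx 0 ord_max.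
have eu : e *m u = 0.
  apply/matrixP => a b; rewrite !mxE big1 // => i _; rewrite !mxE ord1 eqxx /=.
  by case: eqP => [->|_]; rewrite ?mul0r // shift_coef_max mulr0.
suff /mulmx1_unit [] : shift_mx *m (1%:M - u *m e) = 1%:M by [].
rewrite mulmxDl mul1mx mulmxBr mulmx1 -[_ *m (u *m e)]mulmxA [e *m (u *m e)]mulmxA eu.
by rewrite mul0mx mulmx0 subr0 subrK.
Qed.

Lemma mat_act_shift (x : vect k N) : mat_act shift_mx x = shift_point x.
Proof.
apply: boolp.funext => i; rewrite /mat_act /shift_point.
have E j : shift_mx i j = (i == j)%:R + shift_coef i * (j == ord_max)%:R.
  by rewrite !mxE big_ord1 !mxE eqxx.
rewrite (eq_bigr (fun j => (i == j)%:R * x j + shift_coef i * (j == ord_max)%:R * x j)).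
  rewrite big_split /=; congr (_ + _).
    rewrite (bigD1 i) //= eqxx mul1r big1 ?addr0 // => j.
    by rewrite eq_sym => /negPf ->; rewrite mul0r.
  rewrite (bigD1 ord_max) //= eqxx mulr1 big1 ?addr0 // => j /negPf ->.
  by rewrite mulr0 mul0r.
by move=> j _; rewrite E mulrDl.
Qed.

Lemma shift_point_max x : shift_point x ord_max = x ord_max.
Proof. by rewrite /shift_point shift_coef_max mul0r addr0. Qed.

Let Phi := endo_eval (monic_poly_map d g).
Let Psi := endo_eval (monic_poly_map d shifted).

Lemma shift_semiconj (x : vect k N) : shift_point (Psi x) = Phi (shift_point x).
Proof.
apply: boolp.funext => i; rewrite {1}/shift_point.
have Pmax (h : 'I_N -> {mpoly k[N.+1]}) y : endo_eval (monic_poly_map d h) y ord_max = y ord_max ^+ d.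
  by rewrite /endo_eval /monic_poly_map unlift_none rmorphXn /= mevalXU.
have Paff (h : 'I_N -> {mpoly k[N.+1]}) y j :
    endo_eval (monic_poly_map d h) y (affine_var j) = (monic_form d h j).@[y].
  by rewrite /endo_eval /monic_poly_map liftK.
rewrite /Psi /Phi Pmax; have [->|ne] := eqVneq i ord_max.
  by rewrite !Pmax shift_coef_max mul0r addr0 shift_point_max.
have /unlift_some [j -> _] : ord_max != i by rewrite eq_sym.
rewrite !Paff monic_form_shifted mevalB mevalZ rmorphXn /= mevalXU shift_coef_affine subrK.
exact: shift_meval.
Qed.

Lemma shift_conjugate : conjugate (monic_poly_map d g) (monic_poly_map d shifted).
Proof.
exists shift_mx, 1; split; first exact: shift_mx_unit.
split=> [|x]; first exact: oner_neq0.
rewrite !mat_act_shift; have := shift_semiconj x; rewrite /Psi => ->.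
by apply: boolp.funext => i; rewrite mul1r.
Qed.

(** In the affine variables the translation has identity derivative, and the subtracted multiple of
    [x_N^d] has derivative 0. *)
Lemma shift_crit (x : vect k N) :
  crit_cone (monic_poly_map d shifted) x <-> crit_cone (monic_poly_map d g) (shift_point x).
Proof.
rewrite /crit_cone !jacobian_monic -shift_meval.
suff -> : \det (affine_jacobian (monic_form d shifted)) =
    shift (\det (affine_jacobian (monic_form d g))).
  have EH : shift 'X_ord_max = 'X_ord_max by rewrite msubstX shift_coef_max scale0r addr0.
  by rewrite [shift (_ * _)]rmorphM [shift (_ *+ _)]rmorphMn [shift (_ ^+ _)]rmorphXn EH.
rewrite -det_map_mx; congr (\det _); apply/matrixP => i j; rewrite !mxE /=.
rewrite monic_form_shifted mderivB mderivZ mderiv_exp mderivXU affine_var_neq_max.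
by rewrite mulr0 mul0rn scaler0 subr0 shift_mderiv.
Qed.

Lemma shift_point_inj (x y : vect k N) : shift_point x = shift_point y -> x = y.
Proof.
move=> E; have Em : x ord_max = y ord_max by rewrite -shift_point_max E shift_point_max.
apply: boolp.funext => i; have := congr1 (fun z : vect k N => z i) E.
by rewrite /shift_point /= Em => /addIr.
Qed.

Lemma shift_point_surj (y : vect k N) : exists x, shift_point x = y.
Proof.
exists (fun i => y i - shift_coef i * y ord_max); apply: boolp.funext => i.
by rewrite /shift_point shift_coef_max mul0r subr0 subrK.
Qed.

Lemma shift_iter n (x : vect k N) : shift_point (iter n Psi x) = iter n Phi (shift_point x).
Proof. by elim: n => // n IHn; rewrite !iterS shift_semiconj IHn. Qed.

Lemma shift_crit_image n (y : vect k N) :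
  crit_image (monic_poly_map d shifted) n y <->
  crit_image (monic_poly_map d g) n (shift_point y).
Proof.
split=> [[x [cx ->]]|[x [cx E]]].
  exists (shift_point x); split; first exact: (proj1 (shift_crit x) cx).
  exact: (shift_iter n x).
have [x' Ex] := shift_point_surj x; exists x'; split; first by apply/shift_crit; rewrite Ex.
by apply: shift_point_inj; rewrite E shift_iter Ex.
Qed.

Lemma shift_PCF : PCF (monic_poly_map d g) -> PCF (monic_poly_map d shifted).
Proof.
move=> [M HM]; exists M => n; have [i [lt_iM Hi]] := HM n; exists i; split => // y.
by rewrite !shift_crit_image.
Qed.

End Translation.

(** * Enumeration of the normal forms with algebraic coefficients *)

Section Enumeration.
Variables (k : closedFieldType) (N d : nat).

(** An algebraic element is coded by an integer polynomial and a position in the list of its roots;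
    a position outside the list gives 0. *)
Definition coded_root (c : {poly int} * nat) : k :=
  (sval (closed_field_poly_normal (map_poly (intr : int -> k) c.1)))`_c.2.

Lemma coded_root_surj a : algebraic_over_prime a -> exists c, a = coded_root c.
Proof.
move=> [p p0 pa]; rewrite /coded_root.
have [rs Ers] := closed_field_poly_normal (map_poly (intr : int -> k) p).
pose c := (p, index a (sval (closed_field_poly_normal (map_poly (intr : int -> k) p)))).
exists c; rewrite /c /=; case: closed_field_poly_normal => s /= Es.
rewrite nth_index // -root_prod_XsubC; move: pa; rewrite Es rootZ // lead_coef_eq0 //.
Qed.

Definition coded_data (c : {ffun 'I_N * 'X_{1..N.+1 < d} -> {poly int} * nat}) (j : 'I_N) :
    {mpoly k[N.+1]} :=
  \sum_(m : 'X_{1..N.+1 < d} | mdeg m == d.-1) coded_root (c (j, m)) *: 'X_[m].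

Lemma coded_data_homog c : normal_form_data d (coded_data c).
Proof.
move=> j; suff : coded_data c j \is d.-1.-homog for mdeg by [].
by apply: rpred_sum => m /eqP Em; apply: dhomogZ; rewrite dhomogX /= Em.
Qed.

Lemma coded_data_surj (g : 'I_N -> {mpoly k[N.+1]}) : (0 < d)%N -> normal_form_data d g ->
  (forall j m, algebraic_over_prime (g j)@_m) -> exists c, g = coded_data c.
Proof.
move=> d_gt0 homg alg.
have [c Ec] := boolp.choice (fun i : 'I_N * 'X_{1..N.+1 < d} =>
  coded_root_surj (alg i.1 (i.2 : 'X_{1..N.+1}))).
exists [ffun i => c i]; apply: boolp.funext => j.
have lt_d : (d.-1 < d)%N by rewrite prednK.
rewrite (dhomog_expand lt_d (homg j)); apply: eq_bigr => m _.
by rewrite ffunE -Ec.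
Qed.

End Enumeration.

(* The set of conjugacy classes of PCF maps in P_{N,d}(k) is countable
   (i.e. is a countable union of points = 0-dimensional subvarieties):
   there is a sequence of monic polynomials in normal form such that every
   PCF monic polynomial is conjugate to a member of the sequence. *)
Theorem theorem1p1 (k : closedFieldType) (N d : nat)
  (hN : (1 <= N)%N) (hd : (2 <= d)%N)
  (hchar : forall p : nat, p \in [pchar k] -> (d < p)%N) :
  exists s : nat -> ('I_N -> {mpoly k[N.+1]}),
    (forall m, normal_form_data d (s m)) /\
    forall g : 'I_N -> {mpoly k[N.+1]},
      normal_form_data d g ->
      PCF (monic_poly_map d g) ->
      exists m : nat, conjugate (monic_poly_map d g) (monic_poly_map d (s m)).
Proof.
(* Numbers that code nothing are sent to [g = 0], the power map, which is in normal form as well. *)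
exists (fun n => if unpickle n is Some c then @coded_data k N d c else fun=> 0).
split=> [n|g homg pcf].
  by case: unpickle => [c|j]; [exact: coded_data_homog | rewrite /homogeneous_of_degree msupp0].
have d0 : (d%:R : k) != 0 by rewrite (natr_neq0_pchar hchar) // leqnn ltnW.
(* This translation cancels the coefficient of [x_j^(d-1)] in the new [g j]. *)
pose c j := - (g j).@[@unit_point k N j] / d%:R.
have homg' j := shifted_homog c hd homg j.
have [j m|e Ee] := coded_data_surj (ltnW hd) homg'.
  apply: (normalized_PCF_algebraic hd hchar homg') => [i|]; last exact: shift_PCF.
  by rewrite shifted_unit_point // /c divfK // subrr.
exists (pickle e); rewrite pickleK -Ee; exact: shift_conjugate.
Qed.
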